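(* Let $q\in\mathbb{N}$. Assume that the external field is zero ($B=0$) and that $\mathbb{E}[W^2]=\infty$, and fix $\beta>0$. Then any optimizer $s(\beta,0)$ of the variational problem $$\varphi(\beta,0)=\sup_{s\in[0,1]}p_{\beta,0}(s),\qquad p_{\beta,0}(s)=\mathbb{E}\big[\log(\mathrm{e}^{\beta'Ws}+q-1)\big]-\frac{\beta'\mathbb{E}[W]}{2q}\big[(q-1)s^2+2s-1\big],$$ with $\beta'=\mathrm{e}^\beta-1$, satisfies $s(\beta,0)>0$.
   Context: The rank-1 inhomogeneous (generalized) random graph on vertex set $[n]=\{1,\dots,n\}$ with positive weights $(w_i)_{i\in[n]}$ has independent edges, the edge $\{i,j\}$ being present with probability $\frac{w_iw_j}{\ell_n+w_iw_j}$, where $\ell_n=\sum_{i\in[n]}w_i$. Let $F_n(x)=\frac1n\sum_{i\in[n]}\mathbf{1}\{w_i\le x\}$ and let $W_n$ have distribution function $F_n$. It is assumed that $W_n$ converges in distribution to a random variable $W$ with $\mathbb{E}[W]>0$, and that there exist $c>0$ and $\tau>2$ with $1-F_n(w)\le c\,w^{-(\tau-1)}$ for all $w\ge1$ (in particular $\mathbb{E}[W]<\infty$). Expectations in the claim are with respect to $W$. The quantity $\varphi(\beta,0)$ is the limit as $n\to\infty$ of the annealed pressure per particle $\frac1n\log\mathbb{E}[Z_n]$ of the $q$-state Potts model on this graph at inverse temperature $\beta$ and zero field, where $Z_n=\sum_{\boldsymbol{\sigma}\in[q]^n}\exp\big[\beta\sum_{i<j}I_{i,j}\mathbf{1}\{\sigma_i=\sigma_j\}\big]$,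 $I_{i,j}$ is the indicator that the edge $\{i,j\}$ is present, $[q]=\{1,\dots,q\}$, and the expectation of $Z_n$ is over the random graph. An optimizer is a point of $[0,1]$ at which the supremum is attained.
   Formalization: The number of spins q is taken to be at least 2 instead of any natural number: for q = 1 the function p_{β,0} is the constant β'E[W]/2, so s = 0 is an optimizer and the claim fails. *)

(* Defs.v *)
From HB Require Import structures.
From mathcomp Require Import all_boot all_order all_algebra.
From mathcomp Require Import all_classical all_reals all_analysis.
Import Order.TTheory GRing.Theory Num.Theory.
Import numFieldNormedType.Exports.

Set Implicit Arguments.
Unset Strict Implicit.
Unset Printing Implicit Defensive.

Local Open Scope classical_set_scope.
Local Open Scope ring_scope.

(* Potential edges of a graph on 'I_n: each unordered pair {i, j} of distinct
   vertices is represented once, by (i, j) with i < j. *)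
Definition edge (n : nat) := {e : 'I_n * 'I_n | (e.1 < e.2)%N}.

(* A graph is its family of edge indicators I_{i,j}, i < j. *)
Definition graph (n : nat) := {ffun edge n -> bool}.

Definition total_weight (R : realType) (n : nat) (w : 'I_n -> R) : R :=
  \sum_(i < n) w i.

Definition edge_prob (R : realType) (n : nat) (w : 'I_n -> R) (e : edge n) : R :=
  let: (i, j) := val e in w i * w j / (total_weight w + w i * w j).

(* Law of the rank-1 inhomogeneous random graph: the product of the Bernoulli
   laws of the edges. *)
Definition graph_prob (R : realType) (n : nat) (w : 'I_n -> R) (G : graph n) : R :=
  \prod_(e : edge n) (if G e then edge_prob w e else 1 - edge_prob w e).

Definition graph_expectation (R : realType) (n : nat) (w : 'I_n -> R)
    (X : graph n -> R) : R :=
  \sum_(G : graph n) graph_prob w G * X G.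

(* Zero-field q-state Potts partition function of the graph G. *)
Definition potts_partition (R : realType) (q : nat) (beta : R) (n : nat)
    (G : graph n) : R :=
  \sum_(sigma : {ffun 'I_n -> 'I_q})
    expR (beta * \sum_(e : edge n)
                   (G e && (sigma (val e).1 == sigma (val e).2))%:R).

Definition annealed_pressure (R : realType) (q : nat) (beta : R) (n : nat)
    (w : 'I_n -> R) : R :=
  n%:R^-1 * ln (graph_expectation w (@potts_partition R q beta n)).

(* Distribution function F_n of the weight W_n of a uniformly chosen vertex. *)
Definition weight_cdf (R : realType) (n : nat) (w : 'I_n -> R) (x : R) : R :=
  n%:R^-1 * \sum_(i < n) (w i <= x)%R%:R.

(* W_n converges in distribution to W: the distribution functions converge at
   every continuity point of the limiting one. *)
Definition weights_cvg_in_distribution (R : realType) (d : measure_display)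
    (T : measurableType d) (P : probability T R) (W : {RV P >-> R})
    (w : forall n, 'I_n -> R) : Prop :=
  forall x : R, {for x, continuous (cdf W)} ->
    ((weight_cdf (w n) x)%:E @[n --> \oo] --> cdf W x)%E.

(* The objective p_{beta,0}; both expectations are finite for the limiting
   weights under consideration, so that [fine] only changes the type. *)
Definition potts_objective (R : realType) (q : nat) (beta : R)
    (d : measure_display) (T : measurableType d) (P : probability T R)
    (W : {RV P >-> R}) (s : R) : R :=
  let beta' := expR beta - 1 in
  fine ('E_P[(fun t : T => ln (expR (beta' * W t * s) + q%:R - 1))])%E
  - beta' * fine ('E_P[W])%E / (2 * q%:R)
      * ((q%:R - 1) * s ^+ 2 + 2 * s - 1).

Definition potts_sup (R : realType) (q : nat) (beta : R)
    (d : measure_display) (T : measurableType d) (P : probability T R)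
    (W : {RV P >-> R}) : R :=
  sup [set potts_objective q beta W s | s in `[0, 1]].

Definition optimizer (R : realType) (q : nat) (beta : R)
    (d : measure_display) (T : measurableType d) (P : probability T R)
    (W : {RV P >-> R}) (s : R) : Prop :=
  s \in `[0, 1] /\ potts_objective q beta W s = potts_sup q beta W.

(* Main.v *)
Require Import Defs.
From mathcomp Require Import all_boot all_order all_algebra.
From mathcomp Require Import all_classical all_reals all_analysis.
From mathcomp Require Import measurable_realfun.
From mathcomp Require Import ring lra.
Import Order.TTheory GRing.Theory Num.Theory.
Import numFieldNormedType.Exports.
Local Open Scope classical_set_scope.
Local Open Scope ring_scope.

Set Implicit Arguments.
Unset Strict Implicit.
Unset Printing Implicit Defensive.

(** Averaging over the independent edges turns [E Z_n] into the sum over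
    colourings of the product of [1 + beta' p_ij] over monochromatic edges.
    From above this is at most [sum_sigma exp ((2 L)^-1 sum_k V_k^2)], with
    [v = beta' w], [L] the total of [v] and [V_k] the [v]-weight of colour [k];
    from below the same form holds up to [e^{O(1)}] once the weights are
    truncated.  Linearising the squares around the points of a finite grid
    (above) or around one point (below) factorises the sum over colourings, and
    the exponential rate becomes the maximum over [y] in [R^q] of
    [sum_i ln (sum_k e^{y_k v_i}) - L / 2 sum_k y_k^2].

    At a maximiser, [y_k = G_k / L] with [G_k] a Gibbs mean, so the coordinates
    are fixed points of a strictly convex function: they take at most two
    values.  The second-order condition forbids the larger value from occurring
    twice, hence [y = (a + s, a, .., a)] with [q a + s = 1], which is the
    one-parameter problem in [s].  The limit in [n] follows from weak
    convergence, the dyadic form of the tail bound, and equicontinuity in [s].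

    Finally [p s - p 0 >= s^2 (C E[W^2; beta' s W <= 1] - C')], which is positive
    for small [s] since [E[W^2]] is infinite. *)

(** * Maximisation of the mean-field exponent *)

Lemma expR_ge_taylor2 (R : realType) (x : R) :
  0 <= x -> 1 + x + x ^+ 2 / 2 <= expR x.
Proof.
move=> x0.
have -> : 1 + x + x ^+ 2 / 2 = series (exp_coeff x) 3.
  rewrite /series /= /exp_coeff !big_nat_recr //= big_nil /=.
  by rewrite add0r expr0 expr1 divr1 divr1.
apply: nondecreasing_cvgn_le; last exact: is_cvg_series_exp_coeff.
by apply: nondecreasing_series => k _ _; exact: exp_coeff_ge0.
Qed.

(** The right side is the square of [expR (x / 2) - expR (- (x / 2))]. By evenness [x >= 0] may be
    assumed, and then this difference is at least [x]. *)
Lemma expR_addN_ge (R : realType) (x : R) :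
  x ^+ 2 <= expR x + expR (- x) - 2.
Proof.
wlog x0 : x / 0 <= x => [h|].
  have [|/ltW x0] := leP 0 x; first exact: h.
  have := h (- x); rewrite oppr_ge0 opprK sqrrN => /(_ x0).
  by rewrite (addrC (expR (- x))).
have y0 : 0 <= x / 2 by lra.
have := expR_ge_taylor2 y0; set E := _ + _ => hE.
have E0 : 0 < E by rewrite /E; nra.
have h : x <= expR (x / 2) - expR (- (x / 2)).
  rewrite expRN.
  have : (expR (x / 2))^-1 <= E^-1 by rewrite lef_pV2 ?posrE ?expR_gt0.
  suff : x <= E - E^-1 by lra.
  (* With [y = x / 2], the quantity [E^2 - 1 - x E] is exactly [y^4 / 4]. *)
  rewrite -(ler_pM2r E0) mulrBl mulVf ?gt_eqF // /E.
  by rewrite -subr_ge0; have := sqr_ge0 ((x / 2) ^+ 2); lra.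
have hx (z : R) : expR z = expR (z / 2) ^+ 2.
  by rewrite -expRM_natr; congr expR; field.
rewrite hx (hx (- x)) mulNr.
have hp : expR (x / 2) * expR (- (x / 2)) = 1 by exact: expRxMexpNx_1.
move: hp h; set a := expR (x / 2); set c := expR _ => hp h.
by nra.
Qed.

(** The logarithm of [(1 + z)^-1] lies below its tangent at 1, so [ln (1 + z) >= z / (1 + z)], which
    dominates [z - z^2]. *)
Lemma ln1D_ge (R : realType) (z : R) : 0 <= z -> z - z ^+ 2 <= ln (1 + z).
Proof.
move=> z0; have z1 : 0 < 1 + z by lra.
have : ln (1 + z)^-1 <= (1 + z)^-1 - 1.
  rewrite -{1}[(1 + z)^-1](subrK 1) addrC; apply: le_ln1Dx.
  by rewrite ltrBrDr addrC subrr invr_gt0.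
rewrite lnV ?posrE // => h.
have : z - z ^+ 2 <= 1 - (1 + z)^-1; last by lra.
rewrite -(ler_pM2r z1) [leRHS]mulrBl mulVf ?gt_eqF //.
have : 0 <= z ^+ 3 by rewrite exprn_ge0.
by rewrite exprS; nra.
Qed.

(** For [v = beta' w] this is [n] times the objective of the variational problem, with [W_n] in
    place of [W]. *)
Definition mf_pressure (R : realType) (I : finType) (q : nat) (v : I -> R) (s : R) : R :=
  \sum_i ln (expR (s * v i) + q%:R - 1) -
  (\sum_i v i) / (2 * q%:R) * ((q%:R - 1) * s ^+ 2 + 2 * s - 1).

Lemma sum_one_distinguished (R : realType) (q : nat) (k1 : 'I_q.+1)
    (y : 'I_q.+1 -> R) (a : R) (F : R -> R) :
  (forall k, k != k1 -> y k = a) ->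
  \sum_k F (y k) = F (y k1) + (q.+1%:R - 1) * F a.
Proof.
move=> ya; rewrite (bigD1 k1) //=; congr (_ + _).
under eq_bigr => k kk1 do rewrite ya //.
rewrite sumr_const cardC1 card_ord /=.
by rewrite -natr1 addrK mulr_natl.
Qed.

Lemma ln_sum_expR_one_distinguished (R : realType) (q : nat) (k1 : 'I_q.+1)
    (y : 'I_q.+1 -> R) (a s x : R) :
  y k1 = a + s -> (forall k, k != k1 -> y k = a) ->
  ln (\sum_k expR (y k * x)) = a * x + ln (expR (s * x) + q.+1%:R - 1).
Proof.
move=> y1 ya; rewrite (@sum_one_distinguished _ _ k1 _ a (fun z => expR (z * x))) // y1.
have -> : expR ((a + s) * x) + (q.+1%:R - 1) * expR (a * x) =
    expR (a * x) * (expR (s * x) + q.+1%:R - 1).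
  by rewrite mulrDl expRD; ring.
rewrite lnM ?posrE ?expR_gt0 ?expRK //.
by rewrite -natr1 addrA addrK ltr_pwDl ?expR_gt0.
Qed.

(** * Convexity of log-sum-exp and the shape of the maximisers *)

Section finite_optimisation.
Context {R : realType}.
Implicit Types (K : finType).

Lemma sum_expR_gt0 K (k0 : K) (x : K -> R) : 0 < \sum_k expR (x k).
Proof.
by rewrite (bigD1 k0) //= ltr_pwDl ?expR_gt0 // sumr_ge0 //.
Qed.

(* Jensen's inequality for the Gibbs weights, from the tangent of [expR] at
   the mean. *)
Lemma ln_sum_expR_tangent K (k0 : K) (x u : K -> R) :
  ln (\sum_k expR (x k)) +
    \sum_k u k * (expR (x k) / \sum_j expR (x j)) <=
  ln (\sum_k expR (x k + u k)).
Proof.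
set Z := \sum_j expR (x j).
have Z0 : 0 < Z by exact: sum_expR_gt0.
set m := \sum_k u k * _.
rewrite -ler_expR expRD !lnK ?posrE ?(sum_expR_gt0 k0) //.
have -> : Z * expR m = \sum_k expR (x k) * (expR m * (1 + (u k - m))).
  under eq_bigr do rewrite mulrCA mulrDr mulr1 mulrBr.
  rewrite -mulr_sumr big_split /= sumrB -/Z -mulr_suml -/Z.
  suff -> : \sum_k expR (x k) * u k = Z * m by rewrite subrr addr0 mulrC.
  rewrite /m mulr_sumr; apply: eq_bigr => k _.
  by rewrite mulrCA [Z * _]mulrC divfK ?gt_eqF // mulrC.
apply: ler_sum => k _; rewrite expRD ler_pM2l ?expR_gt0 //.
rewrite -{2}(subrK m (u k)) expRD mulrC ler_pM2r ?expR_gt0 //.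
exact: expR_ge1Dx.
Qed.

Variables (I : finType) (q : nat) (v : I -> R).
Hypotheses (v_gt0 : forall i, 0 < v i) (L_gt0 : 0 < \sum_i v i).
Implicit Types (y : 'I_q.+1 -> R).

Let L := \sum_i v i.

Definition gibbs y i k := expR (y k * v i) / \sum_j expR (y j * v i).

(** Rate of the sum over colourings once each [V_k^2 / (2 L)] is replaced by its tangent
    [y_k V_k - L y_k^2 / 2] at [V_k = L y_k]. *)
Definition mf_exponent y :=
  \sum_i ln (\sum_k expR (y k * v i)) - L / 2 * \sum_k y k ^+ 2.

Definition gibbs_mean y k := \sum_i v i * gibbs y i k.

Let Z_gt0 y i : 0 < \sum_j expR (y j * v i).
Proof. exact: sum_expR_gt0 ord0 _. Qed.

Lemma gibbs_gt0 y i k : 0 < gibbs y i k.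
Proof. by rewrite divr_gt0 ?expR_gt0. Qed.

Lemma sum_gibbs y i : \sum_k gibbs y i k = 1.
Proof. by rewrite -mulr_suml divff ?gt_eqF. Qed.

Lemma gibbs_le1 y i k : gibbs y i k <= 1.
Proof.
rewrite -(sum_gibbs y i) (bigD1 k) //= lerDl sumr_ge0 // => j _.
by rewrite ltW ?gibbs_gt0.
Qed.

Lemma gibbs_mean_ge0 y k : 0 <= gibbs_mean y k.
Proof. by rewrite sumr_ge0 // => i _; rewrite mulr_ge0 // ltW ?gibbs_gt0. Qed.

Lemma gibbs_mean_le y k : gibbs_mean y k <= L.
Proof. by apply: ler_sum => i _; rewrite ler_piMr ?gibbs_le1 // ltW. Qed.

Lemma sum_gibbs_mean y : \sum_k gibbs_mean y k = L.
Proof.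
rewrite exchange_big; apply: eq_bigr => i _ /=.
by rewrite -mulr_sumr sum_gibbs mulr1.
Qed.

(** The log-sum-exp part is convex and stays above its tangent; the quadratic part is expanded
    exactly. *)
Lemma mf_exponent_tangent y (h : 'I_q.+1 -> R) :
  mf_exponent y + \sum_k h k * (gibbs_mean y k - L * y k)
    - L / 2 * \sum_k h k ^+ 2 <= mf_exponent (fun k => y k + h k).
Proof.
have hi i : ln (\sum_k expR (y k * v i)) + \sum_k h k * (v i * gibbs y i k) <=
    ln (\sum_k expR ((y k + h k) * v i)).
  have := ln_sum_expR_tangent ord0 (fun k => y k * v i) (fun k => h k * v i).
  under [X in _ <= ln X -> _]eq_bigr do rewrite -mulrDl.
  by under [X in _ + X <= _ -> _]eq_bigr do rewrite -mulrA.
have /(ler_sum (index_enum I)) := fun i (_ : xpredT i) => hi i.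
rewrite big_split /= exchange_big /=.
have -> : \sum_k \sum_i h k * (v i * gibbs y i k) = \sum_k h k * gibbs_mean y k.
  by apply: eq_bigr => k _; rewrite -mulr_sumr.
rewrite /mf_exponent.
set A := \sum_i ln _; set B := \sum_k _ * _; set C := \sum_i ln _ => ABC.
have -> : \sum_k (y k + h k) ^+ 2 =
    \sum_k y k ^+ 2 + 2 * (\sum_k h k * y k) + \sum_k h k ^+ 2.
  by rewrite mulr_sumr -!big_split; apply: eq_bigr => k _ /=; ring.
have -> : \sum_k h k * (gibbs_mean y k - L * y k) = B - L * \sum_k h k * y k.
  by rewrite mulr_sumr /B -sumrB; apply: eq_bigr => k _; ring.
by lra.
Qed.

(** The increment [gibbs_mean y / L - y] maximises the quadratic lower bound of
    [mf_exponent_tangent]. One step of the fixed-point map therefore raises the exponent by a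
    definite amount. *)
Lemma mf_exponent_gibbs_mean y :
  mf_exponent y + L / 2 * \sum_k (gibbs_mean y k / L - y k) ^+ 2 <=
  mf_exponent (fun k => gibbs_mean y k / L).
Proof.
have := mf_exponent_tangent y (fun k => gibbs_mean y k / L - y k).
have -> : mf_exponent (fun k => y k + (gibbs_mean y k / L - y k)) =
    mf_exponent (fun k => gibbs_mean y k / L).
  by congr mf_exponent; apply/funext => k; ring.
apply: le_trans; rewrite le_eqVlt; apply/orP; left; apply/eqP.
have -> : \sum_k (gibbs_mean y k / L - y k) * (gibbs_mean y k - L * y k) =
    L * \sum_k (gibbs_mean y k / L - y k) ^+ 2.
  rewrite mulr_sumr; apply: eq_bigr => k _; field.
  by rewrite gt_eqF.
by field.
Qed.

Let continuous_sum (J : finType) (T : topologicalType) (f : J -> T -> R) :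
  (forall j, continuous (f j)) -> continuous (fun t => \sum_j f j t).
Proof.
by move=> cf; apply: continuous_big => //; exact: add_continuous.
Qed.

Lemma mf_exponent_continuous :
  continuous (fun y : 'rV[R]_q.+1 => mf_exponent (fun k => y ord0 k)).
Proof.
have c1 : continuous (fun y : 'rV[R]_q.+1 => \sum_i ln (\sum_k expR (y ord0 k * v i))).
  apply: continuous_sum => i z.
  apply: (@continuous_comp _ _ _ (fun y : 'rV[R]_q.+1 =>
    \sum_k expR (y ord0 k * v i)) (@ln R)); last first.
    by apply: continuous_ln; exact: Z_gt0.
  apply: continuous_sum => k {}z; apply: (@continuous_comp _ _ _
    (fun y : 'rV[R]_q.+1 => y ord0 k * v i) (@expR R)); last first.
    exact: continuous_expR.
  exact: (@cvgMr_tmp R _ (nbhs z) _ _ _ _ (@coord_continuous R 1 q.+1 ord0 k z)).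
have c2 : continuous (fun y : 'rV[R]_q.+1 => \sum_k y ord0 k ^+ 2).
  apply: continuous_sum => k z.
  apply: (@continuous_comp _ _ _ (fun y : 'rV[R]_q.+1 => y ord0 k)
    (fun x : R => x ^+ 2)).
    exact: (@coord_continuous R 1 q.+1 ord0 k z).
  exact: exprn_continuous.
have Fy (y : 'rV[R]_q.+1) : Filter (nbhs y) by exact: nbhs_filter.
move=> y; have h2 := @cvgMl_tmp R _ (nbhs y) (Fy y) _ (L / 2) _ (c2 y).
by have := @cvgB _ _ _ _ (Fy y) _ _ _ _ (c1 y) h2.
Qed.

(** The domain is not compact, but the fixed-point map sends every point into the unit cube without
    lowering the exponent, so a maximum over the cube is global. *)
Lemma mf_exponent_max : exists y, forall z, mf_exponent z <= mf_exponent y.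
Proof.
pose A := [set y : 'rV[R]_q.+1 | forall k, y ord0 k \in `[0, 1]].
have [|||y _ ymax] := @compact_EVT_max _ R
    (fun y : 'rV[R]_q.+1 => mf_exponent (fun k => y ord0 k)) A.
- by exists (const_mx 0) => k /=; rewrite mxE in_itv /= lexx ler01.
- apply: (@rV_compact R q.+1 (fun=> `[0, 1]%classic)) => _.
  exact: segment_compact.
- exact: (continuous_subspaceT mf_exponent_continuous).
exists (fun k => y ord0 k) => z.
have := ymax (\row_k (gibbs_mean z k / L)).
have -> : mf_exponent (fun k => (\row_k (gibbs_mean z k / L)) ord0 k) =
    mf_exponent (fun k => gibbs_mean z k / L).
  by congr mf_exponent; apply/funext => k; rewrite mxE.
move=> h; apply: le_trans (h _).
  apply: le_trans (mf_exponent_gibbs_mean z).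
  by rewrite lerDl mulr_ge0 ?sumr_ge0 // => *; rewrite ?sqr_ge0 // divr_ge0 ?ltW.
rewrite inE => k /=; rewrite mxE in_itv /= divr_ge0 ?gibbs_mean_ge0 ?(ltW L_gt0) //=.
by rewrite ler_pdivrMr // mul1r gibbs_mean_le.
Qed.

Section maximiser.
Variable y : 'I_q.+1 -> R.
Hypothesis ymax : forall z, mf_exponent z <= mf_exponent y.

(** Otherwise one step of the fixed-point map would strictly increase the exponent. *)
Lemma maximiser_fixpoint k : gibbs_mean y k = L * y k.
Proof.
have := le_trans (mf_exponent_gibbs_mean y) (ymax _).
rewrite gerDl pmulr_rle0 ?divr_gt0 // => h.
have {h} : \sum_k (gibbs_mean y k / L - y k) ^+ 2 == 0.
  by rewrite eq_le h sumr_ge0 // => j _; exact: sqr_ge0.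
rewrite psumr_eq0; last by move=> j _; exact: sqr_ge0.
move=> /allP /(_ k (mem_index_enum _)) /=.
rewrite sqrf_eq0 subr_eq0 => /eqP <-.
by rewrite mulrC divfK ?gt_eqF.
Qed.

Lemma maximiser_sum : \sum_k y k = 1.
Proof.
apply: (mulfI (lt0r_neq0 L_gt0)); rewrite mulr1 -[RHS](sum_gibbs_mean y).
by rewrite mulr_sumr; apply: eq_bigr => k _; rewrite maximiser_fixpoint.
Qed.

Lemma maximiser_ge0 k : 0 <= y k.
Proof. by rewrite -(pmulr_rge0 _ L_gt0) -maximiser_fixpoint gibbs_mean_ge0. Qed.

(** Slope at [y k] of the function of [x] given by the sum of [v_i e^(x v_i) / Z_i], with the
    normalisers [Z_i] frozen at [y]. At a maximiser this function takes the value [L x] at every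
    coordinate [x]. *)
Let Q k := \sum_i v i ^+ 2 * gibbs y i k.

Let I_inh : exists i : I, true.
Proof.
have [/existsP//|/existsPn I0] := boolP [exists i : I, true].
by move: L_gt0; rewrite big1 ?ltxx // => i; have := I0 i.
Qed.

(* Strict convexity of [x |-> e^x]: its graph lies above the tangent at [y k]. *)
Lemma maximiser_convexity k k' : y k' != y k -> 0 < (y k' - y k) * (L - Q k).
Proof.
move=> kk'.
suff : gibbs_mean y k + (y k' - y k) * Q k < gibbs_mean y k'.
  by rewrite !maximiser_fixpoint; lra.
rewrite /gibbs_mean /Q mulr_sumr -big_split /=.
have [i0 _] := I_inh.
have h i : v i * gibbs y i k + (y k' - y k) * (v i ^+ 2 * gibbs y i k) <
    v i * gibbs y i k'.
  have -> : gibbs y i k' = gibbs y i k * expR ((y k' - y k) * v i).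
    by rewrite /gibbs mulrAC -expRD; congr (expR _ / _); ring.
  have -> : v i * gibbs y i k + (y k' - y k) * (v i ^+ 2 * gibbs y i k) =
    v i * gibbs y i k * (1 + (y k' - y k) * v i) by ring.
  rewrite mulrA ltr_pM2l; last exact: mulr_gt0 (v_gt0 i) (gibbs_gt0 y i k).
  by rewrite expR_gt1Dx // mulf_neq0 ?subr_eq0 // gt_eqF.
rewrite (bigD1 i0) //= [ltRHS](bigD1 i0) //=.
by apply: ltr_leD => //; apply: ler_sum => i _; exact: ltW.
Qed.

(* Second-order condition in the direction separating two equal coordinates. *)
Lemma maximiser_second_order k k' : k' != k -> y k' = y k -> Q k <= L.
Proof.
move=> kk' ykk'.
pose C := \sum_i gibbs y i k ^+ 2 * v i ^+ 4.
have C0 : 0 <= C by rewrite sumr_ge0 // => i _; rewrite mulr_ge0 // exprn_even_ge0.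
rewrite leNgt; apply/negP => LQ.
(* Moving the two coordinates by [t] and [- t] costs [t^2 L] in the quadratic part and gains at
   least [t^2 Q - t^4 C]. This [t] makes the gain larger; [C + 1] keeps the denominator positive. *)
pose t := Num.sqrt ((Q k - L) / (C + 1)).
have t2 : t ^+ 2 = (Q k - L) / (C + 1).
  by rewrite sqr_sqrtr // divr_ge0 ?subr_ge0 ?(ltW LQ) ?ler_wpDl.
have t2_gt0 : 0 < t ^+ 2 by rewrite t2 divr_gt0 ?subr_gt0 // ltr_wpDl.
pose z j := if j == k' then y j + t else if j == k then y j - t else y j.
have sum_z (F : R -> R) :
    \sum_j F (z j) = \sum_j F (y j) + (F (y k + t) + F (y k - t) - 2 * F (y k)).
  rewrite (bigD1 k') //= (bigD1 k) 1?eq_sym //=.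
  rewrite [in RHS](bigD1 k') //= [in RHS](bigD1 k) 1?eq_sym //=.
  rewrite /z !eqxx eq_sym (negbTE kk') ykk'.
  under eq_bigr => j /andP[/negbTE -> /negbTE ->] do [].
  by ring.
(* As [y k' = y k], the two moved terms share one Gibbs weight and the linear effects cancel,
   leaving a hyperbolic cosine. *)
have zexp i : \sum_j expR (z j * v i) = (\sum_j expR (y j * v i)) *
    (1 + gibbs y i k * (expR (t * v i) + expR (- (t * v i)) - 2)).
  rewrite (sum_z (fun x => expR (x * v i))) /gibbs.
  rewrite (_ : (y k + t) * v i = y k * v i + t * v i); last by ring.
  rewrite (_ : (y k - t) * v i = y k * v i + - (t * v i)); last by ring.
  rewrite !expRD.
  by field; rewrite gt_eqF.
have := ymax z; apply/negP; rewrite -ltNge /mf_exponent.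
rewrite (sum_z (fun x => x ^+ 2)).
have : \sum_i ln (\sum_j expR (y j * v i)) + (t ^+ 2 * Q k - t ^+ 4 * C) <=
    \sum_i ln (\sum_j expR (z j * v i)).
  rewrite /Q /C !mulr_sumr -sumrB -big_split /=; apply: ler_sum => i _.
  have g0 := gibbs_gt0 y i k.
  have x0 : 0 <= gibbs y i k * (t * v i) ^+ 2 by rewrite mulr_ge0 ?sqr_ge0 // ltW.
  have xz : gibbs y i k * (t * v i) ^+ 2 <=
      gibbs y i k * (expR (t * v i) + expR (- (t * v i)) - 2).
    by rewrite ler_pM2l // expR_addN_ge.
  rewrite zexp lnM ?posrE //; last by rewrite ltr_pwDl // (le_trans x0).
  rewrite lerD2l; apply: le_trans (_ : ln (1 + gibbs y i k * (t * v i) ^+ 2) <= _).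
    apply: le_trans (ln1D_ge x0); rewrite le_eqVlt; apply/orP; left; apply/eqP.
    by ring.
  by rewrite ler_ln ?posrE ?lerD2l // ltr_pwDl // (le_trans x0).
have : t ^+ 2 * L < t ^+ 2 * Q k - t ^+ 4 * C.
  have -> : t ^+ 4 = t ^+ 2 * t ^+ 2 by ring.
  rewrite -mulrA -mulrBr ltr_pM2l // t2.
  have C1 : 0 < C + 1 by rewrite ltr_wpDl.
  suff : (Q k - L) / (C + 1) * C < Q k - L by lra.
  rewrite mulrAC ltr_pdivrMr // ltr_pM2l ?subr_gt0 //.
  by rewrite ltrDl.
lra.
Qed.

(** Let [k] differ from an index [k1] of the maximum. If [y k] exceeds the minimum, convexity gives
    [Q k > L]. Then [y k] is not below the maximum, where convexity would give [Q k < L], and it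
    does not equal the maximum, by the second-order condition. So [y k] is the minimum. *)
Lemma maximiser_shape : exists k1 a, 0 <= a <= y k1 /\ forall k, k != k1 -> y k = a.
Proof.
have [k1 _ hk1] := @arg_maxP _ R _ ord0 xpredT y isT.
have [k0 _ hk0] := @arg_minP _ R _ ord0 xpredT y isT.
exists k1, (y k0); split=> [|k kk1]; first by rewrite maximiser_ge0 hk0.
apply/eqP; apply/negPn/negP => kk0.
have k0k : y k0 < y k by rewrite lt_neqAle eq_sym kk0 hk0.
have := @maximiser_convexity k k0.
rewrite eq_sym kk0 => /(_ isT); rewrite nmulr_rgt0 ?subr_lt0 // => QL.
have [e|ne] := eqVneq (y k1) (y k).
  have := @maximiser_second_order k k1; rewrite eq_sym kk1 e => /(_ isT erefl).
  by rewrite leNgt QL.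
have k1k : y k < y k1 by rewrite lt_neqAle eq_sym ne; exact: hk1.
have := maximiser_convexity ne.
by rewrite pmulr_rgt0 ?subr_gt0 // ltNge ltW.
Qed.

End maximiser.

(** The exponent of a global maximiser bounds that of [y]. Its shape [(a + s, a, .., a)] and the
    constraint that the coordinates sum to 1 eliminate [a], and what remains is the pressure at
    [s]. *)
Lemma mf_exponent_le_pressure (y : 'I_q.+1 -> R) :
  exists2 s, 0 <= s <= 1 & mf_exponent y <= mf_pressure q.+1 v s.
Proof.
have [z zmax] := mf_exponent_max.
have [k1 [a [/andP[a0 az] za]]] := maximiser_shape zmax.
have z1 : z k1 = a + (z k1 - a) by rewrite addrC subrK.
have z_ge0 k : 0 <= z k by exact: maximiser_ge0 zmax k.
set s := z k1 - a in z1; exists s; last first.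
  apply: (le_trans (zmax y)); rewrite /mf_exponent.
  under eq_bigr => i _ do rewrite (ln_sum_expR_one_distinguished _ z1 za).
  rewrite big_split /= -mulr_sumr -/L (sum_one_distinguished (fun x => x ^+ 2) za) z1.
  have := maximiser_sum zmax; rewrite (sum_one_distinguished idfun za) /= z1.
  rewrite /mf_pressure -/L; set q1 : R := q.+1%:R => as1.
  have q0 : q1 != 0 by rewrite pnatr_eq0.
  have -> : s = 1 - q1 * a by rewrite -as1; ring.
  rewrite le_eqVlt; apply/orP; left; apply/eqP.
  by field.
rewrite subr_ge0 az /=; apply: (@le_trans _ _ (z k1)); first by rewrite gerBl.
by rewrite -(maximiser_sum zmax) (bigD1 k1) //= lerDl sumr_ge0.
Qed.

End finite_optimisation.

(** * Annealed partition function *)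

Section partition_function.
Context {R : realType}.
Variables (q n : nat).
Implicit Types (sigma : {ffun 'I_n -> 'I_q}) (e : edge n).

Definition monochromatic sigma e : bool := sigma (val e).1 == sigma (val e).2.

Lemma graph_expectation_potts (beta : R) (w : 'I_n -> R) :
  graph_expectation w (@potts_partition R q beta n) =
  \sum_sigma \prod_(e : edge n)
    (1 + (expR beta - 1) * edge_prob w e * (monochromatic sigma e)%:R).
Proof.
rewrite /graph_expectation /potts_partition.
under eq_bigr do rewrite mulr_sumr.
rewrite exchange_big /=; apply: eq_bigr => sigma _.
pose F e b : R := (if b then edge_prob w e else 1 - edge_prob w e) *
  expR (beta * (b && monochromatic sigma e)%:R).
transitivity (\sum_(G : {ffun edge n -> bool}) \prod_e F e (G e)).
  by apply: eq_bigr => G _; rewrite big_split -expR_sum -mulr_sumr.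
rewrite -bigA_distr_bigA; apply: eq_bigr => e _.
rewrite (bigD1 true) //= (bigD1 false) //= big1 ?addr0; last by case.
rewrite /F /= mulr0 expR0 mulr1.
case: monochromatic; rewrite ?(mulr0, mulr1, expR0); ring.
Qed.

Lemma sum_edges (g : 'I_n -> 'I_n -> R) :
  (forall i j, g i j = g j i) ->
  \sum_i \sum_j g i j =
  2 * (\sum_(e : edge n) g (val e).1 (val e).2) + \sum_i g i i.
Proof.
move=> gC.
have -> : \sum_(e : edge n) g (val e).1 (val e).2 =
    \sum_(i < n) \sum_(j < n | (i < j)%N) g i j.
  rewrite pair_big_dep /= [RHS](reindex_omap (val : edge n -> _) insub) /=.
    by apply: eq_bigl => -[p pp] /=; rewrite insubT pp eqxx.
  by move=> p ?; rewrite insubT.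
have gt : \sum_(i < n) \sum_(j < n | (j < i)%N) g i j =
    \sum_(i < n) \sum_(j < n | (i < j)%N) g i j.
  have swK : involutive (fun p : 'I_n * 'I_n => (p.2, p.1)) by case.
  rewrite !pair_big_dep /= (reindex_inj (inv_inj swK)) /=.
  by apply: eq_bigr => p _; rewrite gC.
rewrite mulr2n mulrDl mul1r -{2}gt -!big_split /=; apply: eq_bigr => i _.
rewrite (bigID (fun j : 'I_n => (i < j)%N)) /= -addrA; congr (_ + _).
rewrite (bigD1 i) ?ltnn //= addrC; congr (_ + _); apply: eq_bigl => j.
by rewrite -leqNgt ltn_neqAle andbC.
Qed.

Definition colour_weight (v : 'I_n -> R) sigma (k : 'I_q) : R :=
  \sum_(i | sigma i == k) v i.

Lemma sum_colour_weight (v : 'I_n -> R) sigma (y : 'I_q -> R) :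
  \sum_k y k * colour_weight v sigma k = \sum_i y (sigma i) * v i.
Proof.
rewrite [RHS](partition_big sigma xpredT) //=; apply: eq_bigr => k _.
by rewrite mulr_sumr; apply: eq_bigr => i /eqP ->.
Qed.

Lemma sum_colour_weight_sqr (v : 'I_n -> R) sigma :
  \sum_i \sum_j v i * v j * (sigma i == sigma j)%:R =
  \sum_k colour_weight v sigma k ^+ 2.
Proof.
under [RHS]eq_bigr do rewrite expr2.
rewrite sum_colour_weight; apply: eq_bigr => i _.
rewrite /colour_weight mulr_suml [RHS]big_mkcond; apply: eq_bigr => j _.
by rewrite eq_sym; case: eqP => _; rewrite ?mulr0 // mulr1 mulrC.
Qed.

(** The exponent is additive over vertices, so the sum over colourings factorises. *)
Lemma sum_colourings (v : 'I_n -> R) (y : 'I_q.+1 -> R) :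
  \sum_(sigma : {ffun 'I_n -> 'I_q.+1}) expR (\sum_i y (sigma i) * v i) =
  expR (\sum_i ln (\sum_k expR (y k * v i))).
Proof.
under eq_bigr do rewrite expR_sum.
rewrite -(bigA_distr_bigA (fun i k => expR (y k * v i))) expR_sum.
apply: eq_bigr => i _; rewrite lnK // posrE.
exact: (@sum_expR_gt0 R _ ord0 (fun k => y k * v i)).
Qed.

End partition_function.

(** The slope of [ln (e^x + c)] is at most 1; concretely, [e^y + c <= (e^x + c) e^(y - x)]. *)
Lemma ln_expRD_lipschitz (R : realType) (c x y : R) :
  0 <= c -> x <= y -> ln (expR y + c) <= ln (expR x + c) + (y - x).
Proof.
move=> c0 xy.
have pos (z : R) : 0 < expR z + c by rewrite ltr_pwDl ?expR_gt0.
rewrite -ler_expR expRD !lnK ?posrE // mulrDl -expRD (addrC x) subrK lerD2l.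
by rewrite ler_peMr // -expR0 ler_expR subr_ge0.
Qed.

(** * Upper and lower bounds for the expected partition function *)

Section partition_function_bounds.
Context {R : realType}.
Variables (q n : nat) (beta : R) (w : 'I_n -> R).
Hypotheses (beta_gt0 : 0 < beta) (w_gt0 : forall i, 0 < w i) (n_gt0 : (0 < n)%N).

Let b := expR beta - 1.
Let b_gt0 : 0 < b. Proof. by rewrite subr_gt0 expR_gt1. Qed.
Let l := total_weight w.
Let l_gt0 : 0 < l.
Proof.
rewrite /l /total_weight (bigD1 (Ordinal n_gt0)) //= ltr_pwDl // sumr_ge0 // => i _.
exact: ltW.
Qed.
Let v i := b * w i.
Let v_gt0 i : 0 < v i. Proof. exact: mulr_gt0. Qed.
Let sum_v : \sum_i v i = b * l. Proof. by rewrite -mulr_sumr. Qed.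
Let L_gt0 : 0 < \sum_i v i. Proof. by rewrite sum_v mulr_gt0. Qed.

Lemma edge_prob_ge0 (e : edge n) : 0 <= edge_prob w e.
Proof.
rewrite /edge_prob; case: (val e) => i j.
by rewrite divr_ge0 ?addr_ge0 ?mulr_ge0 // ltW.
Qed.

Lemma expected_partition_gt0 :
  0 < graph_expectation w (@potts_partition R q.+1 beta n).
Proof.
apply: (@lt_le_trans _ _ 1) => //; rewrite graph_expectation_potts.
rewrite (bigD1 [ffun=> ord0]) //= -[leLHS]addr0.
have fac_ge1 sigma (e : edge n) : 1 <= 1 + (expR beta - 1) * edge_prob w e *
    (monochromatic sigma e : bool)%:R :> R.
  by rewrite lerDl mulr_ge0 // mulr_ge0 ?edge_prob_ge0 // ltW.
have prod_ge1 (sigma : {ffun 'I_n -> 'I_q.+1}) : 1 <= \prod_(e : edge n)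
    (1 + (expR beta - 1) * edge_prob w e * (monochromatic sigma e)%:R).
  apply: le_trans (_ : \prod_(e : edge n) (1 : R) <= _); first by rewrite big1.
  by apply: ler_prod => e _; rewrite ler01 fac_ge1.
by apply: lerD => //; rewrite sumr_ge0 // => sigma _; rewrite (le_trans _ (prod_ge1 _)).
Qed.

(** Three losses, all upwards: [1 + x <= e^x], the term [w_i w_j] dropped from the denominator of
    the edge probability, and the nonnegative diagonal added to complete the square. *)
Lemma expected_partition_le_quadratic :
  graph_expectation w (@potts_partition R q.+1 beta n) <=
  \sum_(sigma : {ffun 'I_n -> 'I_q.+1})
    expR ((2 * \sum_i v i)^-1 * \sum_k colour_weight v sigma k ^+ 2).
Proof.
rewrite graph_expectation_potts; apply: ler_sum => sigma _.
pose g i j := (b * l)^-1 * (v i * v j * (sigma i == sigma j)%:R).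
apply: le_trans (_ : expR (\sum_(e : edge n) g (val e).1 (val e).2) <= _).
  rewrite expR_sum; apply: ler_prod => e _; apply/andP; split.
    by rewrite addr_ge0 // mulr_ge0 // mulr_ge0 ?edge_prob_ge0 // ltW.
  apply: le_trans (expR_ge1Dx _); rewrite lerD2l.
  rewrite /g /v /edge_prob /monochromatic; case: (val e) => i j /=.
  have wij : 0 < w i * w j by exact: mulr_gt0.
  rewrite -/b -/l.
  have -> : (b * l)^-1 * (b * w i * (b * w j) * (sigma i == sigma j)%:R) =
      b * (w i * w j / l) * (sigma i == sigma j)%:R.
    by field; rewrite !gt_eqF.
  rewrite ler_wpM2r // ler_pM2l // ler_pM2l // lef_pV2 ?posrE ?addr_gt0 //.
  by rewrite lerDl ltW.
rewrite ler_expR invfM -sum_colour_weight_sqr sum_v.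
have := @sum_edges _ _ g.
have gC i j : g i j = g j i by rewrite /g [v i * v j]mulrC eq_sym.
move=> /(_ gC).
have -> : \sum_i \sum_j g i j =
    (b * l)^-1 * \sum_i \sum_j v i * v j * (sigma i == sigma j)%:R.
  by rewrite mulr_sumr; apply: eq_bigr => i _; rewrite mulr_sumr.
have : 0 <= \sum_i g i i.
  by rewrite sumr_ge0 // => i _; rewrite /g !mulr_ge0 ?invr_ge0 ?mulr_ge0 // ltW.
lra.
Qed.

(** Take [y_k] to be [V_k / L] rounded down to a multiple of [1 / N]. Completing the square leaves
    the error [(V_k - L y_k)^2 / (2 L)], at most [L / (2 N^2)] for each colour. *)
Lemma quadratic_le_grid (N : nat) (sigma : {ffun 'I_n -> 'I_q.+1}) : (0 < N)%N ->
  exists j : {ffun 'I_q.+1 -> 'I_N.+1},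
    (2 * \sum_i v i)^-1 * \sum_k colour_weight v sigma k ^+ 2 <=
    \sum_i (j (sigma i))%:R / N%:R * v i
      - (\sum_i v i) / 2 * \sum_k ((j k)%:R / N%:R) ^+ 2
      + q.+1%:R * (\sum_i v i) / (2 * N%:R ^+ 2).
Proof.
move=> N_gt0; set L := \sum_i v i; have L0 : 0 < L := L_gt0.
have N0 : 0 < N%:R :> R by rewrite ltr0n.
pose V := colour_weight v sigma.
have V_ge0 k : 0 <= V k by rewrite sumr_ge0 // => i _; exact: ltW.
have V_leL k : V k <= L.
  rewrite /L (bigID (fun i => sigma i == k)) /= lerDl sumr_ge0 // => i _.
  exact: ltW.
have VL k : 0 <= V k / L * N%:R by rewrite mulr_ge0 // divr_ge0 // ltW.
(* The value [N] is reached when all vertices have colour [k], hence [N.+1] grid points per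
   colour. *)
pose j := [ffun k => inord (Num.truncn (V k / L * N%:R)) : 'I_N.+1].
have jE k : (j k : nat) = Num.truncn (V k / L * N%:R).
  rewrite ffunE inordK // ltnS -(ler_nat R).
  apply: le_trans (_ : V k / L * N%:R <= _); first by rewrite truncn_le.
  by rewrite ler_piMl // ler_pdivrMr // mul1r; exact: V_leL.
exists j.
rewrite -(sum_colour_weight v sigma (fun k => (j k)%:R / N%:R)).
rewrite -/V.
have -> : q.+1%:R * L / (2 * N%:R ^+ 2) = \sum_(k < q.+1) L / (2 * N%:R ^+ 2).
  by rewrite sumr_const card_ord -mulrA mulr_natl.
clearbody L; rewrite !mulr_sumr -sumrB -big_split /=; apply: ler_sum => k _.
set y := _ / _.
have h : (V k - L * y) ^+ 2 <= (L / N%:R) ^+ 2.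
  have /andP[h1 h2] := truncn_itv (VL k).
  rewrite -jE in h1 h2.
  have e : V k - L * y = L / N%:R * (V k / L * N%:R - (j k)%:R).
    by rewrite /y; field; rewrite !gt_eqF.
  rewrite e exprMn ler_piMr ?sqr_ge0 //.
  rewrite expr_le1 ?subr_ge0 // lerBlDr addrC natr1.
  exact: ltW.
have e : (2 * L)^-1 * V k ^+ 2 =
    y * V k - L / 2 * y ^+ 2 + (2 * L)^-1 * (V k - L * y) ^+ 2.
  by field; rewrite gt_eqF.
rewrite e lerD2l.
have -> : L / (2 * N%:R ^+ 2) = (2 * L)^-1 * (L / N%:R) ^+ 2.
  by field; rewrite !gt_eqF.
by rewrite ler_pM2l // invr_gt0 mulr_gt0.
Qed.

(** Each grid point contributes at most [expR (B + err)] after factorisation; the grid has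
    [N.+1 ^ q.+1] points, which gives the last logarithmic term. *)
Lemma ln_expected_partition_le (N : nat) (B : R) : (0 < N)%N ->
  (forall s, 0 <= s <= 1 -> mf_pressure q.+1 v s <= B) ->
  ln (graph_expectation w (@potts_partition R q.+1 beta n)) <=
  B + q.+1%:R * (\sum_i v i) / (2 * N%:R ^+ 2) + q.+1%:R * ln N.+1%:R.
Proof.
move=> N_gt0 hB.
set err := q.+1%:R * _ / _.
have N1 : 0 < N.+1%:R :> R by rewrite ltr0n.
suff h : graph_expectation w (@potts_partition R q.+1 beta n) <=
    N.+1%:R ^+ q.+1 * expR (B + err).
  have E0 := expected_partition_gt0.
  have := h; rewrite -ler_ln ?posrE ?mulr_gt0 ?exprn_gt0 ?expR_gt0 //.
  rewrite lnM ?posrE ?exprn_gt0 ?expR_gt0 // expRK lnXn //.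
  by rewrite mulr_natl addrC.
apply: le_trans expected_partition_le_quadratic _.
pose y (j : {ffun 'I_q.+1 -> 'I_N.+1}) k : R := (j k)%:R / N%:R.
(* The good grid point depends on [sigma]; summing over the whole grid removes this dependence and
   lets the two sums be exchanged. *)
apply: le_trans (_ : \sum_(sigma : {ffun 'I_n -> 'I_q.+1})
  \sum_(j : {ffun 'I_q.+1 -> 'I_N.+1})
    expR (\sum_i y j (sigma i) * v i) *
    expR (err - (\sum_i v i) / 2 * \sum_k y j k ^+ 2) <= _).
  apply: ler_sum => sigma _.
  have [j hj] := quadratic_le_grid sigma N_gt0.
  rewrite (bigD1 j) //= -expRD.
  apply: le_trans (_ : expR _ <= _); first by rewrite ler_expR; exact: hj.
  rewrite -/err (_ : _ - _ + err = \sum_i y j (sigma i) * v i +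
    (err - (\sum_i v i) / 2 * \sum_k y j k ^+ 2)); last by rewrite /y; ring.
  by rewrite lerDl sumr_ge0 // => k _; rewrite mulr_ge0 ?expR_ge0.
rewrite exchange_big /=.
have -> : N.+1%:R ^+ q.+1 * expR (B + err) =
    \sum_(j : {ffun 'I_q.+1 -> 'I_N.+1}) expR (B + err).
  by rewrite sumr_const card_ffun !card_ord -natrX mulr_natl.
apply: ler_sum => j _.
rewrite -mulr_suml sum_colourings -expRD ler_expR.
have [s s01 hs] := mf_exponent_le_pressure v_gt0 L_gt0 (y j).
have := le_trans hs (hB s s01); rewrite /mf_exponent; lra.
Qed.

(** Truncation gives a common denominator: the edge probability is at least [u_i u_j / (l + M^2)].
    With [ln (1 + x) >= x - x^2] the losses are the diagonal and the squares, and both stay bounded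
    when [l] is of order [n] and [M] is fixed. *)
Lemma quadratic_le_expected_partition (M : R) (u : 'I_n -> R) : 0 < M ->
  (forall i, 0 < u i) -> (forall i, u i <= M) -> (forall i, u i <= w i) ->
  expR (- (n%:R * b * M ^+ 2 / (2 * l) + (n%:R * b * M ^+ 2) ^+ 2 / (2 * l ^+ 2))) *
  (\sum_(sigma : {ffun 'I_n -> 'I_q.+1})
    expR (b / (2 * (l + M ^+ 2)) * \sum_k colour_weight u sigma k ^+ 2)) <=
  graph_expectation w (@potts_partition R q.+1 beta n).
Proof.
move=> M_gt0 u_gt0 uM uw; set D := l + M ^+ 2.
have D_gt0 : 0 < D by rewrite addr_gt0 // exprn_gt0.

pose x i j := b * (u i * u j / D).
have x_ge0 i j : 0 <= x i j by rewrite ltW // mulr_gt0 // divr_gt0 // mulr_gt0.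
have x_le i j : x i j <= b * M ^+ 2 / l.
  rewrite -[leRHS]mulrA ler_pM2l //; apply: ler_pM.
  - by rewrite ltW // mulr_gt0.
  - by rewrite invr_ge0 ltW.
  - by rewrite expr2; apply: ler_pM; rewrite ?uM // ltW.
  - by rewrite lef_pV2 ?posrE // lerDl ltW // exprn_gt0.
rewrite graph_expectation_potts mulr_sumr; apply: ler_sum => sigma _.
pose g i j := (x i j - x i j ^+ 2) * (sigma i == sigma j)%:R.
apply: le_trans (_ : expR (\sum_(e : edge n) g (val e).1 (val e).2) <= _); last first.
  rewrite expR_sum; apply: ler_prod => e _; rewrite expR_ge0 /=.
  have := edge_prob_ge0 e; rewrite /g /edge_prob /monochromatic.
  case: e => -[i j] ij /= p_ge0; case: (sigma i == sigma j); last first.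
    by rewrite /= mulr0n !mulr0 addr0 expR0.
  rewrite /= mulr1n !mulr1 -[leRHS]lnK ?ler_expR; last first.
    by rewrite posrE ltr_pwDl // mulr_ge0 // ltW.
  apply: le_trans (ln1D_ge (x_ge0 i j)) _.
  rewrite ler_ln ?posrE ?lerD2l ?ltr_pwDl //; last first.
    by rewrite mulr_ge0 // ltW.
  rewrite ler_pM2l // -/l.
  have wij : 0 < w i * w j by rewrite mulr_gt0.
  have uij : 0 < u i * u j by rewrite mulr_gt0.
  (* After cross-multiplication the terms compare separately: [u_i u_j <= w_i w_j] for the factor
     [l], and [u_i u_j <= M^2] for the factor [w_i w_j]. *)
  rewrite ler_pdivrMr // mulrAC ler_pdivlMr ?addr_gt0 //.
  have : u i * u j <= w i * w j by rewrite ler_pM // ltW.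
  have : u i * u j <= M ^+ 2 by rewrite expr2 ler_pM // ltW.
  move=> aM aw; rewrite !mulrDr lerD //; first by rewrite ler_wpM2r // ltW.
  by rewrite mulrC ler_wpM2l // ltW.
rewrite -expRD ler_expR.
have gC i j : g i j = g j i by rewrite /g /x [u i * u j]mulrC eq_sym.
have := sum_edges gC.
have -> : \sum_i \sum_j g i j =
    b / D * (\sum_i \sum_j u i * u j * (sigma i == sigma j)%:R) -
    \sum_i \sum_j x i j ^+ 2 * (sigma i == sigma j)%:R.
  rewrite mulr_sumr -sumrB; apply: eq_bigr => i _.
  by rewrite mulr_sumr -sumrB; apply: eq_bigr => j _; rewrite /g /x; ring.
rewrite sum_colour_weight_sqr.
have hx2 : \sum_(i < n) \sum_(j < n) x i j ^+ 2 * (sigma i == sigma j)%:R <=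
    (n%:R * b * M ^+ 2) ^+ 2 / l ^+ 2.
  have -> : (n%:R * b * M ^+ 2) ^+ 2 / l ^+ 2 =
      \sum_(i < n) \sum_(j < n) (b * M ^+ 2 / l) ^+ 2.
    rewrite !sumr_const !card_ord -mulrnA -[RHS]mulr_natl natrM.
    by field; rewrite gt_eqF.
  apply: ler_sum => i _; apply: ler_sum => j _.
  apply: le_trans (_ : x i j ^+ 2 <= _); first last.
    by rewrite ler_sqr ?nnegrE ?x_le // divr_ge0 ?mulr_ge0 ?sqr_ge0 // ltW.
  by rewrite ler_piMr ?sqr_ge0 ?lern1 ?leq_b1.
have hd : \sum_i g i i <= n%:R * b * M ^+ 2 / l.
  have -> : n%:R * b * M ^+ 2 / l = \sum_(i < n) (b * M ^+ 2 / l).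
    by rewrite sumr_const card_ord -!mulrA mulr_natl.
  apply: ler_sum => i _; rewrite /g eqxx mulr1.
  by apply: le_trans (x_le i i); rewrite gerBl sqr_ge0.
have -> : b / (2 * D) = (b / D) / 2 by field; rewrite gt_eqF.
have -> : n%:R * b * M ^+ 2 / (2 * l) = (n%:R * b * M ^+ 2 / l) / 2.
  by field; rewrite gt_eqF.
have -> : (n%:R * b * M ^+ 2) ^+ 2 / (2 * l ^+ 2) =
    ((n%:R * b * M ^+ 2) ^+ 2 / l ^+ 2) / 2.
  by field; rewrite gt_eqF.
rewrite [b / D / 2 * _]mulrAC.
lra.
Qed.

(** Every square is bounded below by its tangent at the single point [y = (a + s, a, .., a)].
    Undoing the truncation costs at most [b] times the truncated mass twice, once in the linear term
    and once in the Lipschitz logarithm; the [M^2] in [D] costs [b M^2 / 2]. *)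
Lemma ln_expected_partition_ge (M s : R) : 0 < M -> 0 <= s <= 1 ->
  mf_pressure q.+1 v s - 2 * b * (\sum_i (w i - Num.min (w i) M)) -
    (b * M ^+ 2 / 2 + (n%:R * b * M ^+ 2 / (2 * l) +
      (n%:R * b * M ^+ 2) ^+ 2 / (2 * l ^+ 2))) <=
  ln (graph_expectation w (@potts_partition R q.+1 beta n)).
Proof.
move=> M_gt0 /andP[s0 s1].
pose u i := Num.min (w i) M.
have u_gt0 i : 0 < u i by rewrite lt_min w_gt0.
have uM i : u i <= M by rewrite ge_min lexx orbT.
have uw i : u i <= w i by rewrite ge_min lexx.
have := quadratic_le_expected_partition M_gt0 u_gt0 uM uw.
set err := _ + _ / (2 * l ^+ 2); set D := l + M ^+ 2.
have D_gt0 : 0 < D by rewrite addr_gt0 // exprn_gt0.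
set q1 : R := q.+1%:R.
have q1_gt0 : 0 < q1 by rewrite ltr0n.
have q1_ge1 : 1 <= q1 by rewrite ler1n.
pose a := (1 - s) / q1.
have a_ge0 : 0 <= a by rewrite divr_ge0 ?subr_ge0 // ltW.
have as1 : q1 * a + s = 1 by rewrite /a; field; rewrite gt_eqF.
pose y (k : 'I_q.+1) := if k == ord0 then a + s else a.
have y0 : y ord0 = a + s by rewrite /y eqxx.
have ya k : k != ord0 -> y k = a by rewrite /y => /negbTE ->.
pose bu i := b * u i.
pose Y := \sum_k y k ^+ 2.
have YE : Y = (a + s) ^+ 2 + (q1 - 1) * a ^+ 2.
  by rewrite /Y (sum_one_distinguished (fun x => x ^+ 2) ya) y0.
(* The [y_k] form a probability vector. *)
have Y1 : Y <= 1.
  have aq : 0 <= (q1 - 1) * a by rewrite mulr_ge0 ?subr_ge0.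
  have sum1 : (a + s) + (q1 - 1) * a = 1 by move: as1; lra.
  have a_le1 : a <= 1 by move: sum1; lra.
  have p2 : (a + s) ^+ 2 <= a + s.
    by rewrite expr2 ler_piMl ?addr_ge0 //; move: sum1; lra.
  have := ler_wpM2l aq a_le1; rewrite mulr1 YE; move: sum1 p2.
  rewrite expr2 -mulrA => *; lra.
pose X := \sum_i ln (\sum_k expR (y k * bu i)).
have XE : X = a * b * (l - \sum_i (w i - u i)) +
    \sum_i ln (expR (s * bu i) + q1 - 1).
  rewrite /X; under eq_bigr => i _ do rewrite (ln_sum_expR_one_distinguished _ y0 ya).
  rewrite big_split /= -mulr_sumr -mulr_sumr sumrB /l /total_weight; ring.
have h : expR (X - b * D / 2 * Y) <=
    \sum_(sigma : {ffun 'I_n -> 'I_q.+1})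
      expR (b / (2 * D) * \sum_k colour_weight u sigma k ^+ 2).
  rewrite expRD -sum_colourings mulr_suml; apply: ler_sum => sigma _.
  rewrite -expRD ler_expR.
  have -> : \sum_i y (sigma i) * bu i = b * \sum_k y k * colour_weight u sigma k.
    by rewrite sum_colour_weight mulr_sumr; apply: eq_bigr => i _; rewrite mulrCA.
  rewrite /Y !mulr_sumr -sumrB; apply: ler_sum => k _.
  set U := colour_weight u sigma k; rewrite -subr_ge0.
  have -> : b / (2 * D) * U ^+ 2 - (b * (y k * U) - b * D / 2 * y k ^+ 2) =
      b / (2 * D) * (U - D * y k) ^+ 2 by field; rewrite gt_eqF.
  by rewrite mulr_ge0 ?sqr_ge0 // divr_ge0 ?mulr_ge0 // ltW.
move=> {}h'; have {h h'} := le_trans (ler_wpM2l (expR_ge0 (- err)) h) h'.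
rewrite -expRD -[X in _ <= X -> _]lnK ?posrE ?expected_partition_gt0 // ler_expR.
apply: le_trans; rewrite /mf_pressure sum_v XE -/q1.
have hF : \sum_i ln (expR (s * v i) + q1 - 1) <=
    \sum_i ln (expR (s * bu i) + q1 - 1) + s * b * \sum_i (w i - u i).
  rewrite mulr_sumr -big_split /=; apply: ler_sum => i _.
  rewrite -!addrA; have -> : s * b * (w i - u i) = s * v i - s * bu i.
    by rewrite /v /bu; ring.
  rewrite ln_expRD_lipschitz ?subr_ge0 // ler_wpM2l // ler_wpM2l //.
  exact: ltW.
have D0 : 0 <= \sum_i (w i - u i) by rewrite sumr_ge0 // => i _; rewrite subr_ge0.
move: hF D0; rewrite -/u; set S1 := \sum_i ln _; set S2 := \sum_i ln _.
set dl := \sum_i _ => hF D0.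
have e : a * b * l - b * l / 2 * Y =
    - (b * l / (2 * q1) * ((q1 - 1) * s ^+ 2 + 2 * s - 1)).
  by rewrite YE /a; field; rewrite gt_eqF.
have h1 : s * b * dl <= b * dl by rewrite -mulrA ler_piMl // mulr_ge0 // ltW.
have h2 : a * b * dl <= b * dl.
  rewrite -mulrA ler_piMl //; first by rewrite mulr_ge0 // ltW.
  have : 0 <= (q1 - 1) * a by rewrite mulr_ge0 ?subr_ge0.
  by move: as1; lra.
have h3 : b * M ^+ 2 / 2 * Y <= b * M ^+ 2 / 2.
  by rewrite ler_piMr // divr_ge0 // mulr_ge0 ?sqr_ge0 // ltW.
move: e; set G := b * l / (2 * q1) * _ => e.
rewrite /D; move: hF h1 h2 h3 e.
clear XE; clearbody S1 S2 dl err G Y; move: (a) => a'; lra.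
Qed.

End partition_function_bounds.

(** * Weak convergence of the weights *)

(** A monotone function has countably many discontinuities; they form a null set, which cannot fill
    an interval. *)
Lemma cdf_continuity_point_between (R : realType) (d : measure_display)
    (T : measurableType d) (P : probability T R) (W : {RV P >-> R}) (a b : R) :
  a < b -> exists2 x, a < x < b & {for x, continuous (cdf W)}.
Proof.
move=> ab; pose F := fine \o cdf W.
have FE x : (F x)%:E = cdf W x by rewrite /F /= fineK // fin_num_measure.
have ndF : {homo F : x y / x <= y}.
  by move=> x y xy; rewrite -lee_fin !FE; exact: cdf_nondecreasing.
have F01 x : 0 <= F x <= 1.
  by rewrite -!lee_fin FE cdf_ge0 cdf_le1.
have := @discontinuity_countable R a b F (in2W ndF).
move=> /countable_lebesgue_measure0 D0.
have [x [xab xD]] : exists x, (x \in `]a, b[) /\ ~ discontinuity F x.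
  apply: contrapT => /forallNP h.
  have : [set x | (x \in `]a, b[) /\ discontinuity F x] = `]a, b[%classic.
    apply/seteqP; split => x /= => [[]//|xab]; split => //.
    by apply: contrapT => xD; apply: (h x).
  move=> e; move: D0; rewrite e lebesgue_measure_itv /= lte_fin ab -EFinB.
  by move=> /eqP; rewrite eqe subr_eq0 gt_eqF.
exists x; first by move: xab; rewrite in_itv.
have cr : F y @[y --> x^'+] --> F x.
  by apply/fine_cvg; rewrite FE; exact: cdf_right_continuous.
have cl : cvg (F y @[y --> x^'-]).
  apply: nondecreasing_at_left_is_cvgr.
    by near=> z => u t _ _; exact: ndF.
  by near=> z; exists 1 => _ [u _ <-]; case/andP: (F01 u).
(* [xD] excludes distinct one-sided limits. The right one is [F x] by right continuity of the
   distribution function, hence so is the left one. *)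
have cF : {for x, continuous F}.
  apply/left_right_continuousP; split=> //.
  have -> : F x = lim (F y @[y --> x^'-]).
    apply/eqP; rewrite eq_sym; apply/negPn/negP => ne; apply: xD; split => //.
      by apply/cvg_ex; exists (F x).
    by move/cvg_lim : (cr) => ->.
  exact: cl.
have -> : cdf W = EFin \o F by apply/funext => y; rewrite /= FE.
by rewrite /continuous_at; apply: cvg_EFin => //; exact: nearW.
Unshelve. all: by end_near. Qed.

(** * Empirical means and their limits for bounded Lipschitz functions *)

Definition weight_mean (R : realType) (n : nat) (w : 'I_n -> R) (f : R -> R) : R :=
  n%:R^-1 * \sum_i f (w i).

Section weight_mean.
Context {R : realType}.
Variables (n : nat) (w : 'I_n -> R).
Hypothesis n_gt0 : (0 < n)%N.

Let n0 : 0 < n%:R :> R. Proof. by rewrite ltr0n. Qed.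

Lemma weight_mean_cst a : weight_mean w (fun=> a) = a.
Proof.
by rewrite /weight_mean sumr_const card_ord -[a *+ n]mulr_natl mulKf ?gt_eqF.
Qed.

Lemma weight_meanD f g :
  weight_mean w (fun x => f x + g x) = weight_mean w f + weight_mean w g.
Proof. by rewrite /weight_mean big_split mulrDr. Qed.

Lemma weight_meanB f g :
  weight_mean w (fun x => f x - g x) = weight_mean w f - weight_mean w g.
Proof. by rewrite /weight_mean sumrB mulrBr. Qed.

Lemma weight_meanZ a f : weight_mean w (fun x => a * f x) = a * weight_mean w f.
Proof. by rewrite /weight_mean -mulr_sumr mulrCA. Qed.

Lemma weight_mean_le f g : (forall i, f (w i) <= g (w i)) ->
  weight_mean w f <= weight_mean w g.
Proof. by move=> fg; rewrite ler_wpM2l ?invr_ge0 ?(ltW n0) //; exact: ler_sum. Qed.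

Lemma weight_mean_dist_le f g a : (forall i, `|f (w i) - g (w i)| <= a) ->
  `|weight_mean w f - weight_mean w g| <= a.
Proof.
move=> h; rewrite -weight_meanB ler_norml; apply/andP; split.
  rewrite -[leLHS]weight_mean_cst; apply: weight_mean_le => i.
  by have := h i; rewrite ler_norml => /andP[].
rewrite -[leRHS]weight_mean_cst; apply: weight_mean_le => i.
by have := h i; rewrite ler_norml => /andP[].
Qed.

End weight_mean.

(** The mean of a combination of half-line indicators is affine in values of the distribution
    function, so weak convergence applies to it directly. [A] is the value to the right of all
    nodes. *)
Definition step_function (R : realType) (A : R) (a x : nat -> R) (K : nat) (y : R) : R :=
  A + \sum_(j < K) a j * (y <= x j)%R%:R.

Lemma step_function_last (R : realType) A (a x : nat -> R) K (y : R) :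
  (forall j, x j < x j.+1) -> x K < y -> step_function A a x K y = A.
Proof.
move=> xS Ky; rewrite /step_function big1 ?addr0 // => j _.
rewrite leNgt (le_lt_trans _ Ky) ?mulr0 //.
have xle : {homo x : i j / (i <= j)%N >-> i <= j}.
  by apply: homo_leq => //; [exact: le_trans | move=> i; exact: ltW].
by apply: xle; exact: ltnW.
Qed.

(** With these coefficients the sum telescopes: the step function equals [g (x j.+1)] between [x j]
    and [x j.+1], and [g (x 0)] below the first node. *)
Lemma step_function_approx (R : realType) (g : R -> R) (x : nat -> R) (eta : R) K :
  (forall j, x j < x j.+1) -> (forall y, y <= x 0%N -> g y = g (x 0%N)) -> 0 <= eta ->
  (forall j y, x j < y <= x j.+1 -> `|g (x j.+1) - g y| <= eta) ->
  forall y, y <= x K ->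
  `|step_function (g (x K)) (fun j => g (x j) - g (x j.+1)) x K y - g y| <= eta.
Proof.
move=> xS g0 eta0 geta; elim: K => [|K IH] y yK.
  by rewrite /step_function big_ord0 addr0 (g0 y) // subrr normr0.
have [yK'|Ky] := leP y (x K); last first.
  rewrite /step_function big_ord_recr /= [y <= x K]leNgt Ky mulr0 addr0.
  rewrite -/(step_function _ (fun j => g (x j) - g (x j.+1)) x K y).
  by rewrite step_function_last //; apply: geta; rewrite Ky.
rewrite /step_function big_ord_recr /= yK' mulr1.
have := IH y yK'; rewrite /step_function.
by set S := \sum_(j < K) _; rewrite (_ : g (x K) + S = g (x K.+1) + (S + (g (x K) - g (x K.+1)))); last ring.
Qed.

Section weak_convergence.
Context {R : realType} {d : measure_display} {T : measurableType d}.
Context {P : probability T R}.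
Variables (W : {RV P >-> R}) (w : forall n, 'I_n -> R).
Arguments w : clear implicits.
Hypothesis w_cvg : weights_cvg_in_distribution W w.

Lemma integrable_bounded_comp (g : R -> R) (B : R) :
  measurable_fun setT g -> (forall x, `|g x| <= B) ->
  P.-integrable setT (EFin \o (fun t => g (W t))).
Proof.
move=> mg gB; apply: measurable_bounded_integrable => //.
- by rewrite (le_lt_trans (probability_le1 P measurableT)) ?ltry.
- exact: measurableT_comp.
- exists B; split; first exact: num_real.
  by move=> B' BB' t _; apply: le_trans (gB _) _; exact: ltW.
Qed.

Lemma integrable_indicator x :
  P.-integrable setT (EFin \o (fun t => (W t <= x)%R%:R)).
Proof.
apply: (@integrable_bounded_comp (fun y => (y <= x)%R%:R) 1).
  rewrite (_ : (fun _ => _) = \1_(`]-oo, x]%classic : set R)); first by [].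
  by apply/funext => y; rewrite indicE mem_setE in_itv.
by move=> y; case: (y <= x); rewrite ?normr1 ?normr0.
Qed.

Lemma Rintegral_indicator x : \int[P]_t (W t <= x)%R%:R = fine (cdf W x).
Proof.
rewrite /Rintegral; congr fine.
rewrite (eq_integral (fun t => (\1_(W @^-1` `]-oo, x]%classic) t)%:E)); last first.
  move=> t _; rewrite indicE; congr ((nat_of_bool _)%:R%:E).
  by apply/idP/idP; rewrite inE /= in_itv.
by rewrite integral_indic ?setIT //; exact: measurable_funPTI.
Qed.

Lemma integrable_step_function A (a x : nat -> R) K :
  P.-integrable setT (EFin \o (fun t => step_function A a x K (W t))).
Proof.
elim: K => [|K IH].
  rewrite (_ : _ \o _ = EFin \o cst A); last first.
    by apply/funext => t; rewrite /step_function /= big_ord0 addr0.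
  exact: finite_measure_integrable_cst.
rewrite (_ : _ \o _ = (EFin \o (fun t => step_function A a x K (W t))) \+
  (fun t => (a K)%:E * (EFin \o (fun t => (W t <= x K)%R%:R)) t)%E); last first.
  by apply/funext => t; rewrite /step_function /= big_ord_recr /= -EFinM -EFinD addrA.
by apply: integrableD => //; apply: integrableZl => //; exact: integrable_indicator.
Qed.

Lemma Rintegral_step_function A (a x : nat -> R) K :
  \int[P]_t step_function A a x K (W t) = A + \sum_(j < K) a j * fine (cdf W (x j)).
Proof.
elim: K => [|K IH].
  rewrite big_ord0 addr0 -[RHS]mulr1.
  have <- : fine (P [set: T]) = 1 by rewrite probability_setT.
  rewrite -Rintegral_cst //; apply: eq_Rintegral => t _.
  by rewrite /step_function big_ord0 addr0.
rewrite (@eq_Rintegral _ _ _ P setT (fun t => step_function A a x K (W t) +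
    a K * (W t <= x K)%R%:R)); last first.
  by move=> t _; rewrite /step_function big_ord_recr /= addrA.
rewrite RintegralD //; last 2 first.
- exact: integrable_step_function.
- exact: (integrableZl _ _ (integrable_indicator (x K))).
rewrite IH RintegralZl ?Rintegral_indicator //; last exact: integrable_indicator.
by rewrite big_ord_recr /= addrA.
Qed.

Lemma weight_mean_step_function A (a x : nat -> R) K :
  (forall j, {for x j, continuous (cdf W)}) ->
  weight_mean (w n) (step_function A a x K) @[n --> \oo] -->
    \int[P]_t step_function A a x K (W t).
Proof.
move=> xc; rewrite Rintegral_step_function.
have h : A + \sum_(j < K) a j * weight_cdf (w n) (x j) @[n --> \oo] -->
    A + \sum_(j < K) a j * fine (cdf W (x j)).
  apply: cvgD; first exact: cvg_cst.
  apply: cvg_big => [|j _]; first exact: add_continuous.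
  apply: cvgMl_tmp; have := w_cvg (xc j).
  by rewrite -[cdf W _]fineK ?fin_num_measure // => /fine_cvg.
apply: cvg_trans h; apply: near_eq_cvg; near=> n.
have n0 : (0 < n)%N by near: n; exists 1%N.
rewrite /step_function weight_meanD weight_mean_cst //; congr (_ + _).
rewrite /weight_cdf /weight_mean; under eq_bigr do rewrite mulrCA mulr_sumr.
by rewrite -mulr_sumr exchange_big.
Unshelve. all: by end_near. Qed.

(** Being constant outside a bounded interval, [g] is uniformly close to a step function with
    finitely many nodes, all at continuity points of the limiting distribution function. *)
Lemma weight_mean_cvg_bounded (g : R -> R) (C M : R) :
  measurable_fun setT g -> 0 <= C ->
  (forall x y, `|g x - g y| <= C * `|x - y|) ->
  (forall x, x <= 0 -> g x = g 0) -> (forall x, M <= x -> g x = g M) ->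
  weight_mean (w n) g @[n --> \oo] --> \int[P]_t g (W t).
Proof.
move=> mg C0 glip g0 gM; apply/cvgrPdist_le => e e0.
(* Consecutive nodes will be less than [2 dl] apart, so [g] oscillates by at most [e / 3] between
   them; [C + 1] covers [C = 0]. *)
pose dl := e / (6 * (C + 1)).
have C1 : 0 < C + 1 by rewrite ltr_wpDl.
have dl0 : 0 < dl by rewrite divr_gt0 // mulr_gt0.
(* One continuity point is picked in each interval of length [dl] ending at [j dl]: the nodes
   increase strictly and the first one is negative. *)
have /choice[x hx] : forall j : nat, exists x : R,
    j%:R * dl - dl < x < j%:R * dl /\ {for x, continuous (cdf W)}.
  move=> j; have [|x ? ?] :=
    cdf_continuity_point_between W (_ : j%:R * dl - dl < j%:R * dl).
    by rewrite gtrBl.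
  by exists x.
have xl j : j%:R * dl - dl < x j by have [/andP[]] := hx j.
have xr j : x j < j%:R * dl by have [/andP[]] := hx j.
have xS j : x j < x j.+1.
  by apply: lt_trans (xr j) _; have := xl j.+1; rewrite -natr1 mulrDl mul1r addrK.
have [K hK] : exists K, M <= x K.
  exists (Num.truncn (`|M| / dl)).+2; apply: le_trans (ltW (xl _)).
  rewrite -natr1 mulrDl mul1r addrK -ler_pdivrMr //.
  apply: le_trans (_ : `|M| / dl <= _); first by rewrite ler_pM2r ?invr_gt0 // ler_norm.
  exact/ltW/truncnS_gt.
pose h := step_function (g (x K)) (fun j => g (x j) - g (x j.+1)) x K.
have x00 : x 0%N <= 0 by have := xr 0%N; rewrite mul0r => /ltW.
have hg y : `|h y - g y| <= e / 3.
  have [yK|Ky] := leP y (x K); last first.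
    rewrite /h step_function_last // (gM _ hK) (gM y (le_trans hK (ltW Ky))).
    by rewrite subrr normr0 divr_ge0 // ltW.
  apply: step_function_approx => //.
  - by move=> z zx; rewrite g0 ?(g0 (x 0%N)) // (le_trans zx).
  - by rewrite divr_ge0 ?ltW.
  move=> j z /andP[jz zj]; apply: le_trans (glip _ _) _.
  have : `|x j.+1 - z| <= 2 * dl.
    rewrite ger0_norm ?subr_ge0 //.
    by have := xl j; have := xr j.+1; rewrite -natr1 mulrDl mul1r; lra.
  move=> hz; apply: le_trans (_ : C * (2 * dl) <= _); first by rewrite ler_wpM2l.
  have -> : e / 3 = (C + 1) * (2 * dl) by rewrite /dl; field; rewrite gt_eqF.
  by apply: ler_wpM2r; [rewrite mulr_ge0 // (ltW dl0) | rewrite lerDl].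
have gB y : `|g y| <= `|g 0| + C * `|M|.
  have [y0|y0] := leP y 0.
    by rewrite g0 // lerDl mulr_ge0.
  have key z : 0 <= z -> z <= `|M| -> `|g z| <= `|g 0| + C * `|M|.
    move=> z0 zM; rewrite -(subrK (g 0) (g z)) addrC.
    apply: le_trans (ler_normD _ _) _; rewrite lerD2l.
    apply: le_trans (glip _ _) _; rewrite ler_wpM2l // subr0 ger0_norm //.
  have [yM|My] := leP y M.
    by apply: key; [exact: ltW | rewrite (le_trans yM) // ler_norm].
  rewrite (gM y (ltW My)); have [M0|M0] := leP M 0.
    by rewrite g0 // lerDl mulr_ge0.
  by apply: key; [exact: ltW | rewrite ler_norm].
have ig := integrable_bounded_comp mg gB.
have ih := integrable_step_function (g (x K)) (fun j => g (x j) - g (x j.+1)) x K.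
have I1 : `|\int[P]_t h (W t) - \int[P]_t g (W t)| <= e / 3.
  have iB : P.-integrable setT (EFin \o (fun t => h (W t) - g (W t))).
    exact: (integrableB measurableT ih ig).
  rewrite -RintegralB //; apply: le_trans (le_normr_Rintegral measurableT iB) _.
  have -> : e / 3 = \int[P]_(t in setT) (e / 3).
    rewrite Rintegral_cst // (_ : fine _ = 1) ?mulr1 //.
    exact: (congr1 fine (probability_setT P)).
  apply: le_Rintegral => //.
  - exact: integrable_norm iB.
  - exact: finite_measure_integrable_cst.
have := @weight_mean_step_function (g (x K)) (fun j => g (x j) - g (x j.+1)) x K
  (fun j => (hx j).2).
move=> /cvgrPdist_le /(_ _ (divr_gt0 e0 (ltr0Sn _ 2))) hn; near=> n.
have n0 : (0 < n)%N by near: n; exists 1%N.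
have I2 : `|\int[P]_t h (W t) - weight_mean (w n) h| <= e / 3 by near: n.
have I3 : `|weight_mean (w n) h - weight_mean (w n) g| <= e / 3.
  exact: weight_mean_dist_le.
move: I1 I2 I3; rewrite !ler_norml => /andP[? ?] /andP[? ?] /andP[? ?].
apply/andP; split; lra.
Unshelve. all: by end_near. Qed.

End weak_convergence.

(** * Uniform integrability from the power-law tail *)

Section dyadic_tail.
Context {R : realType}.
Implicit Types (x : R).

(** Raising the truncation level from [p] to [2 p] adds at most [p], and nothing unless [p < x]. *)
Lemma min_dyadic_le x (m j : nat) :
  Num.min x (2 ^+ (m + j)) - Num.min x (2 ^+ m) <=
  \sum_(k < j) 2 ^+ (m + k) * (2 ^+ (m + k) < x)%R%:R.
Proof.
elim: j => [|j IH]; first by rewrite addn0 subrr big_ord0.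
rewrite big_ord_recr /= addnS.
suff : Num.min x (2 ^+ (m + j).+1) - Num.min x (2 ^+ (m + j)) <=
    2 ^+ (m + j) * (2 ^+ (m + j) < x)%R%:R by move: IH; lra.
set p : R := 2 ^+ (m + j); have p0 : 0 <= p by rewrite exprn_ge0.
rewrite exprS -/p; have [px|xp] := ltP p x.
  rewrite mulr1 lerBlDr; apply: le_trans (_ : 2 * p <= _); last by lra.
  by rewrite ge_min lexx orbT.
rewrite mulr0 subr_le0 ge_min lexx //.
Qed.

(** Common ratio of the terms [2^k (2^k)^(-(tau - 1))] that bound the dyadic layers; it is below 1
    because [tau > 2]. *)
Definition dyadic_ratio (tau : R) : R := 2 `^ (2 - tau).

Lemma dyadic_ratio_gt0 tau : 0 < dyadic_ratio tau.
Proof. exact: powR_gt0. Qed.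

Lemma dyadic_ratio_lt1 tau : 2 < tau -> dyadic_ratio tau < 1.
Proof.
move=> tau2; rewrite /dyadic_ratio /powR pnatr_eq0 /= expR_lt1.
by rewrite pmulr_llt0 ?subr_lt0 // ln_gt0 // ltr1n.
Qed.

Lemma dyadic_ratioX tau k :
  2 ^+ k * (2 ^+ k) `^ (- (tau - 1)) = dyadic_ratio tau ^+ k.
Proof.
rewrite /dyadic_ratio -(powR_mulrn k (powR_ge0 _ _)) -(powR_mulrn k) //.
rewrite -!powRrM -powRD; first by congr (_ `^ _); ring.
by rewrite pnatr_eq0 implybT.
Qed.

(** Sum from index [m] on of the geometric series with ratio [dyadic_ratio tau], times [c]. *)
Definition tail_bound (c tau : R) (m : nat) : R :=
  c / (1 - dyadic_ratio tau) * dyadic_ratio tau ^+ m.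

Lemma tail_bound_ge0 c tau m : 0 < c -> 2 < tau -> 0 <= tail_bound c tau m.
Proof.
move=> c0 tau2; rewrite mulr_ge0 ?exprn_ge0 ?ltW ?dyadic_ratio_gt0 //.
by rewrite divr_gt0 // subr_gt0 dyadic_ratio_lt1.
Qed.

Lemma tail_bound_cvg0 c tau : 2 < tau -> tail_bound c tau m @[m --> \oo] --> 0.
Proof.
move=> tau2; rewrite -[X in _ --> X](mulr0 (c / (1 - dyadic_ratio tau))).
apply: cvgMl_tmp; apply: cvg_expr; rewrite ger0_norm ?dyadic_ratio_lt1 //.
exact/ltW/dyadic_ratio_gt0.
Qed.

Variables (c tau : R).
Hypotheses (c_gt0 : 0 < c) (tau_gt2 : 2 < tau).
Variables (n : nat) (w : 'I_n -> R).
Hypotheses (n_gt0 : (0 < n)%N)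
  (w_tail : forall x, 1 <= x -> 1 - weight_cdf w x <= c * x `^ (- (tau - 1))).

Lemma weight_mean_tail x : 1 <= x ->
  weight_mean w (fun y => (x < y)%R%:R) <= c * x `^ (- (tau - 1)).
Proof.
move=> x1; apply: le_trans (w_tail x1).
have -> : 1 - weight_cdf w x = weight_mean w (fun y => 1 - (y <= x)%R%:R).
  by rewrite weight_meanB weight_mean_cst.
apply: weight_mean_le => // i.
by case: (ltP x (w i)) => _; rewrite /= ?subr0 ?subrr.
Qed.

Lemma weight_mean_min_dyadic_le m j :
  weight_mean w (fun x => Num.min x (2 ^+ (m + j)) - Num.min x (2 ^+ m)) <=
  tail_bound c tau m.
Proof.
apply: le_trans (_ : weight_mean w (fun x =>
  \sum_(k < j) 2 ^+ (m + k) * (2 ^+ (m + k) < x)%R%:R) <= _).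
  by apply: weight_mean_le => // i; exact: min_dyadic_le.
have -> : weight_mean w (fun x =>
    \sum_(k < j) 2 ^+ (m + k) * (2 ^+ (m + k) < x)%R%:R) =
    \sum_(k < j) 2 ^+ (m + k) * weight_mean w (fun x => (2 ^+ (m + k) < x)%R%:R).
  under [RHS]eq_bigr do rewrite /weight_mean mulrCA mulr_sumr.
  by rewrite -mulr_sumr exchange_big.
set r := dyadic_ratio tau.
have r0 : 0 < r by exact: dyadic_ratio_gt0.
have r1 : r < 1 by exact: dyadic_ratio_lt1.
apply: le_trans (_ : \sum_(k < j) c * r ^+ (m + k) <= _).
  apply: ler_sum => k _; rewrite -dyadic_ratioX [leRHS]mulrCA ler_wpM2l ?exprn_ge0 //.
  by apply: weight_mean_tail; rewrite exprn_ege1 // ler1n.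
rewrite -mulr_sumr; under eq_bigr do rewrite exprD.
rewrite -mulr_sumr /tail_bound -/r -mulrA ler_pM2l //.
have -> : (1 - r)^-1 * r ^+ m = r ^+ m * (1 - r)^-1 by rewrite mulrC.
rewrite ler_pM2l ?exprn_gt0 // -[leRHS]mul1r ler_pdivlMr ?subr_gt0 // mulrC.
have := subrX1 r j; have : 0 <= r ^+ j by rewrite exprn_ge0 // ltW.
lra.
Qed.

(** For fixed [n] the weights are finitely many, so some level [m + j] truncates none of them, and
    the dyadic bound is uniform in [j]. *)
Lemma weight_mean_minus_min_le m :
  weight_mean w (fun x => x - Num.min x (2 ^+ m)) <= tail_bound c tau m.
Proof.
have [j hj] : exists j, forall i, w i <= 2 ^+ (m + j).
  exists (Num.truncn (\sum_i `|w i|)).+1 => i.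
  apply: le_trans (ler_norm _) _; apply: le_trans (_ : \sum_i `|w i| <= _).
    by rewrite (bigD1 i) //= lerDl sumr_ge0.
  apply: le_trans (ltW (truncnS_gt _)) _.
  apply: le_trans (_ : 2 ^+ (Num.truncn (\sum_i `|w i|)).+1 <= _).
    by rewrite -natrX ler_nat ltnW // ltn_expl.
  by rewrite ler_weXn2l ?ler1n // leq_addl.
apply: le_trans (weight_mean_min_dyadic_le m j).
by apply: weight_mean_le => // i; rewrite (min_idPl (hj i)).
Qed.

End dyadic_tail.

Lemma min_dist (R : realType) (x y M : R) :
  `|Num.min x M - Num.min y M| <= `|x - y|.
Proof.
wlog xy : x y / x <= y.
  by move=> h; have [/h//|/ltW/h] := leP x y; rewrite distrC (distrC y).
rewrite !ler0_norm ?subr_le0 //; last by rewrite le_min !ge_min xy lexx orbT.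
by case: (leP x M); case: (leP y M) => ? ?; lra.
Qed.

Lemma max_dist (R : realType) (x y M : R) :
  `|Num.max x M - Num.max y M| <= `|x - y|.
Proof.
wlog xy : x y / x <= y.
  by move=> h; have [/h//|/ltW/h] := leP x y; rewrite distrC (distrC y).
rewrite !ler0_norm ?subr_le0 //; last by rewrite ge_max !le_max xy lexx orbT.
by case: (leP x M); case: (leP y M) => ? ?; lra.
Qed.

(** * Integrability of the limit and convergence of means of Lipschitz functions *)

Section weak_limit.
Context {R : realType} {d : measure_display} {T : measurableType d}.
Context {P : probability T R}.
Variables (W : {RV P >-> R}) (w : forall n, 'I_n -> R).
Arguments w : clear implicits.
Hypotheses (w_cvg : weights_cvg_in_distribution W w)
  (w_gt0 : forall n i, 0 < w n i).
Variables (c tau : R).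
Hypotheses (c_gt0 : 0 < c) (tau_gt2 : 2 < tau)
  (w_tail : forall (n : nat) (x : R), (0 < n)%N -> 1 <= x ->
       1 - weight_cdf (w n) x <= c * x `^ (- (tau - 1))).

(** As a weak limit of positive variables, [W] is nonnegative only almost surely; this version is
    nonnegative everywhere. *)
Definition positive_part (t : T) : R := Num.max (W t) 0.

Let V := positive_part.

Lemma positive_part_ge0 t : 0 <= V t.
Proof. by rewrite le_max lexx orbT. Qed.

Lemma measurable_positive_part : measurable_fun setT V.
Proof. exact: measurable_maxr. Qed.

(** At a continuity point between [x] and 0 all empirical distribution functions vanish. *)
Lemma cdf_neg x : x < 0 -> cdf W x = 0%E.
Proof.
move=> x0; have [y /andP[xy y0] yc] := cdf_continuity_point_between W x0.
apply/eqP; rewrite eq_le cdf_ge0 andbT.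
have <- : cdf W y = 0%E; last by apply: cdf_nondecreasing; exact: ltW.
apply: cvg_unique (w_cvg yc) _ => //.
rewrite (_ : (fun n => (weight_cdf (w n) y)%:E) = cst 0%E); first exact: cvg_cst.
apply/funext => n; rewrite /weight_cdf big1 ?mulr0 // => i _.
by rewrite leNgt (lt_trans y0).
Qed.

Lemma ae_positive_part : {ae P, forall t, W t = V t}.
Proof.
have h k : P.-negligible (W @^-1` `]-oo, - k.+1%:R^-1]%classic).
  exists (W @^-1` `]-oo, - k.+1%:R^-1]%classic); split => //.
    exact: measurable_funPTI.
  by apply: cdf_neg; rewrite oppr_lt0 invr_gt0.
apply: negligibleS (negligible_bigcup h) => t /=.
move=> nWV; have W0 : W t < 0.
  by rewrite ltNge; apply/negP => W0; apply: nWV; rewrite /V /positive_part (max_idPl W0).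
have [k hk] : exists k : nat, k.+1%:R^-1 <= - W t.
  have nW : 0 < - W t by rewrite oppr_gt0.
  exists (Num.truncn (- W t)^-1); rewrite -[leRHS]invrK lef_pV2 ?posrE ?invr_gt0 //.
  exact/ltW/truncnS_gt.
by exists k => //=; rewrite in_itv /= lerNr.
Qed.

Lemma integral_positive_part (f : R -> R) : measurable_fun setT f ->
  (\int[P]_t (f (W t))%:E = \int[P]_t (f (V t))%:E)%E.
Proof.
move=> mf; apply: ae_eq_integral => //.
- by apply/measurable_EFinP; exact: measurableT_comp.
- apply/measurable_EFinP; apply: measurableT_comp => //.
  exact: measurable_positive_part.
by apply: filterS ae_positive_part => t /= <-.
Qed.

Lemma integrable_lipschitz_comp (f : R -> R) (C : R) (X : T -> R) :
  measurable_fun setT f -> measurable_fun setT X -> (forall t, 0 <= X t) ->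
  (forall x y, `|f x - f y| <= C * `|x - y|) ->
  P.-integrable setT (EFin \o X) -> P.-integrable setT (EFin \o (f \o X)).
Proof.
move=> mf mX X0 flip iX.
apply: (@le_integrable _ _ _ P setT measurableT _
  (EFin \o (fun t => `|f 0| + `|C| * X t))).
- by apply/measurable_EFinP; exact: measurableT_comp.
- move=> t _; rewrite /= lee_fin [leRHS]ger0_norm ?addr_ge0 ?mulr_ge0 //.
  rewrite -(subrK (f 0) (f (X t))) addrC.
  apply: le_trans (ler_normD _ _) _; rewrite lerD2l.
  apply: le_trans (flip _ _) _; rewrite subr0 (ger0_norm (X0 t)).
  by rewrite ler_wpM2r // ler_norm.
rewrite (_ : _ \o _ = (EFin \o cst `|f 0|) \+
  (fun t => `|C|%:E * (EFin \o X) t)%E); last first.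
  by apply/funext => t /=; rewrite -EFinM -EFinD.
apply: integrableD => //; first exact: finite_measure_integrable_cst.
exact: integrableZl.
Qed.

Lemma measurable_min_cst (M : R) : measurable_fun setT (fun x : R => Num.min x M).
Proof. by apply: measurable_minr => //; exact: measurable_id. Qed.

(** Inserting [Num.max x 0] makes the function constant on the negative half-line, as the bounded
    case requires, and leaves its values at the positive weights unchanged. *)
Lemma weight_mean_cvg_min (f : R -> R) (C M : R) :
  measurable_fun setT f -> 0 <= C -> 0 <= M ->
  (forall x y, `|f x - f y| <= C * `|x - y|) ->
  weight_mean (w n) (fun x => f (Num.min x M)) @[n --> \oo] -->
    \int[P]_t f (Num.min (V t) M).
Proof.
move=> mf C0 M0 flip.
have := @weight_mean_cvg_bounded _ _ _ _ W w w_cvg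
  (fun x => f (Num.min (Num.max x 0) M)) C M.
have -> : (fun n => weight_mean (w n) (fun x => f (Num.min (Num.max x 0) M))) =
    (fun n => weight_mean (w n) (fun x => f (Num.min x M))).
  apply/funext => n; rewrite /weight_mean; congr (_ * _).
  by apply: eq_bigr => i _; rewrite (max_idPl (ltW (w_gt0 i))).
apply => //.
- apply: (measurableT_comp mf); apply: (measurableT_comp (measurable_min_cst M)).
  by apply: measurable_maxr => //; exact: measurable_id.
- move=> x y; apply: le_trans (flip _ _) _.
  by rewrite ler_wpM2l // (le_trans (min_dist _ _ _)) // max_dist.
- by move=> x x0; rewrite (max_idPr x0) (max_idPr (lexx 0)).
move=> x Mx; rewrite (max_idPl (le_trans M0 Mx)) (max_idPl M0).
by rewrite (min_idPr Mx) (min_idPl (lexx M)).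
Qed.

Let V_diff m j t := Num.min (V t) (2 ^+ (m + j)) - Num.min (V t) (2 ^+ m).

Lemma V_diff_ge0 m j t : 0 <= V_diff m j t.
Proof.
by rewrite subr_ge0 le_min !ge_min lexx /= ler_weXn2l ?ler1n ?leq_addr ?orbT.
Qed.

Lemma V_diff_le m j t : V_diff m j t <= 2 ^+ (m + j).
Proof.
rewrite /V_diff lerBlDr -[leLHS]addr0 lerD //; first by rewrite ge_min lexx orbT.
by rewrite le_min positive_part_ge0 exprn_ge0.
Qed.

Lemma measurable_V_diff m j : measurable_fun setT (V_diff m j).
Proof.
have mV := measurable_positive_part.
by apply: measurable_funB; apply: (measurableT_comp (measurable_min_cst _)).
Qed.

Lemma integrable_V_diff m j : P.-integrable setT (EFin \o V_diff m j).
Proof.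
apply: measurable_bounded_integrable => //.
- by rewrite (le_lt_trans (probability_le1 P measurableT)) ?ltry.
- exact: measurable_V_diff.
exists (2 ^+ (m + j)); split; first exact: num_real.
move=> B' BB' t _; rewrite /= ger0_norm ?V_diff_ge0 //.
by apply: le_trans (V_diff_le _ _ _) _; exact: ltW.
Qed.

(** The difference of two truncations is bounded and Lipschitz, so the bound, uniform in [n], passes
    to the weak limit. *)
Lemma Rintegral_V_diff_le m j : \int[P]_t V_diff m j t <= tail_bound c tau m.
Proof.
pose f x : R := Num.min x (2 ^+ (m + j)) - Num.min x (2 ^+ m).
have flip x y : `|f x - f y| <= 2 * `|x - y|.
  have h1 := min_dist x y (2 ^+ (m + j)); have h2 := min_dist x y (2 ^+ m).
  rewrite /f; move: h1 h2; rewrite !ler_norml => /andP[? ?] /andP[? ?].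
  by apply/andP; split; lra.
have mf : measurable_fun setT f by apply: measurable_funB; exact: measurable_min_cst.
have fM x : f (Num.min x (2 ^+ (m + j))) = f x.
  rewrite /f -!minA minxx; congr (_ - Num.min _ _).
  by apply/min_idPr; rewrite ler_weXn2l ?ler1n ?leq_addr.
have := weight_mean_cvg_min mf (ler0n _ 2)
  (exprn_ge0 (m + j) (ler0n R 2)) flip.
rewrite (_ : (fun t => f _) = V_diff m j); last by apply/funext => t; rewrite fM.
move=> /cvgr_to_le; apply; near=> n.
under eq_fun do rewrite fM.
apply: weight_mean_min_dyadic_le => //; first by near: n; exists 1%N.
by move=> x x1; apply: w_tail => //; near: n; exists 1%N.
Unshelve. all: by end_near. Qed.

(** Monotone convergence as the upper level [m + j] grows. The integral is kept in the extended
    reals because the integrability of [V] is deduced from this bound. *)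
Lemma integral_minus_min_le m :
  (\int[P]_t (V t - Num.min (V t) (2 ^+ m))%:E <= (tail_bound c tau m)%:E)%E.
Proof.
have := @cvg_monotone_convergence _ _ _ P setT measurableT (fun j t => (V_diff m j t)%:E).
have -> : (fun t => limn (fun j => (V_diff m j t)%:E)) =
    (fun t => (V t - Num.min (V t) (2 ^+ m))%:E).
  apply/funext => t; apply/cvg_lim => //.
  apply: cvg_near_cst; near=> j; congr (_%:E); rewrite /V_diff; congr (_ - _).
  apply/min_idPl; apply: le_trans (ltW (truncnS_gt (V t))) _.
  have jV : (Num.truncn (V t) < j)%N by near: j; exists (Num.truncn (V t)).+1.
  apply: le_trans (_ : j%:R <= _); first by rewrite ler_nat.
  apply: le_trans (_ : 2 ^+ j <= _); first by rewrite -natrX ler_nat ltnW // ltn_expl.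
  by rewrite ler_weXn2l ?ler1n ?leq_addl.
move=> h; apply: (cvge_to_le (h _ _ _)).
- by move=> j; apply/measurable_EFinP; exact: measurable_V_diff.
- by move=> j t _; rewrite lee_fin V_diff_ge0.
- move=> t _ j k jk; rewrite lee_fin lerD2r le_min !ge_min lexx /=.
  by rewrite ler_weXn2l ?ler1n ?leq_add2l ?orbT.
near=> j.
rewrite -[leLHS]fineK; last by apply: integrable_fin_num => //; exact: integrable_V_diff.
by rewrite lee_fin; exact: Rintegral_V_diff_le.
Unshelve. all: by end_near. Qed.

Lemma integrable_minus_min m :
  P.-integrable setT (EFin \o (fun t => V t - Num.min (V t) (2 ^+ m))).
Proof.
have mV := measurable_positive_part.
apply/integrableP; split.
  apply/measurable_EFinP; apply: measurable_funB => //.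
  exact: (measurableT_comp (measurable_min_cst _)).
rewrite (le_lt_trans _ (ltry (tail_bound c tau m))) //.
rewrite (eq_integral (fun t => (V t - Num.min (V t) (2 ^+ m))%:E)).
  exact: integral_minus_min_le.
by move=> t _; rewrite /= ger0_norm // subr_ge0 ge_min lexx.
Qed.

Lemma integrable_min (M : R) : 0 <= M ->
  P.-integrable setT (EFin \o (fun t => Num.min (V t) M)).
Proof.
move=> M0; apply: measurable_bounded_integrable => //.
- by rewrite (le_lt_trans (probability_le1 P measurableT)) ?ltry.
- apply: (measurableT_comp (measurable_min_cst M)).
  exact: measurable_positive_part.
exists M; split; first exact: num_real.
move=> B' BB' t _; rewrite /= ger0_norm ?le_min ?positive_part_ge0 //.
by rewrite ge_min (ltW BB') orbT.
Qed.

Lemma integrable_positive_part : P.-integrable setT (EFin \o V).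
Proof.
have := integrableD measurableT (integrable_minus_min 0)
  (@integrable_min (2 ^+ 0) (exprn_ge0 _ (ler0n _ 2))).
by apply: eq_integrable => // t _; rewrite /= -EFinD subrK.
Qed.

(** Truncation at [2^m] changes both means by at most [C] times the tail bound, uniformly in [n];
    the truncated means converge by the bounded case. *)
Lemma weight_mean_cvg (f : R -> R) (C : R) :
  measurable_fun setT f -> 0 <= C ->
  (forall x y, `|f x - f y| <= C * `|x - y|) ->
  weight_mean (w n) f @[n --> \oo] --> \int[P]_t f (V t).
Proof.
move=> mf C0 flip; apply/cvgrPdist_le => e e0.
have C1 : 0 < C + 1 by rewrite ltr_wpDl.
have e3 : 0 < e / (3 * (C + 1)) by rewrite divr_gt0 // mulr_gt0.
have /cvgrPdist_le /(_ _ e3) [m _ hm] := tail_bound_cvg0 c tau_gt2.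
have {hm} Cm : C * tail_bound c tau m <= e / 3.
  have := hm m (leqnn m); rewrite sub0r normrN ger0_norm ?tail_bound_ge0 // => h.
  apply: le_trans (_ : (C + 1) * tail_bound c tau m <= _).
    by rewrite ler_wpM2r ?tail_bound_ge0 // lerDl.
  apply: le_trans (ler_wpM2l (ltW C1) h) _.
  by rewrite le_eqVlt; apply/orP; left; apply/eqP; field; rewrite gt_eqF.
have fd x : `|f x - f (Num.min x (2 ^+ m))| <= C * (x - Num.min x (2 ^+ m)).
  by apply: le_trans (flip _ _) _; rewrite (@ger0_norm _ (x - _)) // subr_ge0 ge_min lexx.
have iV := integrable_positive_part.
have mV := measurable_positive_part.
have if1 : P.-integrable setT (EFin \o (f \o V)).
  by apply: (integrable_lipschitz_comp mf mV positive_part_ge0 flip iV).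
have if2 : P.-integrable setT (EFin \o (f \o (fun t => Num.min (V t) (2 ^+ m)))).
  apply: (integrable_lipschitz_comp mf _ _ flip).
  - exact: (measurableT_comp (measurable_min_cst _) mV).
  - by move=> t; rewrite le_min positive_part_ge0 exprn_ge0.
  - by apply: integrable_min; rewrite exprn_ge0.
have I1 : `|\int[P]_t f (V t) - \int[P]_t f (Num.min (V t) (2 ^+ m))| <= e / 3.
  have iB : P.-integrable setT (EFin \o (fun t => f (V t) - f (Num.min (V t) (2 ^+ m)))).
    exact: (integrableB measurableT if1 if2).
  rewrite -RintegralB //; apply: le_trans (le_normr_Rintegral measurableT iB) _.
  apply: le_trans Cm.
  apply: le_trans (_ : \int[P]_t (C * (V t - Num.min (V t) (2 ^+ m))) <= _).
    apply: le_Rintegral => //.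
    - exact: integrable_norm iB.
    - exact: (integrableZl measurableT C (integrable_minus_min m)).
  rewrite RintegralZl //; last exact: integrable_minus_min.
  rewrite ler_wpM2l // -lee_fin fineK; first exact: integral_minus_min_le.
  by apply: integrable_fin_num => //; exact: integrable_minus_min.
have := @weight_mean_cvg_min f C (2 ^+ m) mf C0 (exprn_ge0 _ (ler0n _ 2)) flip.
move=> /cvgrPdist_le /(_ _ (divr_gt0 e0 (ltr0Sn _ 2))) hn; near=> n.
have n0 : (0 < n)%N by near: n; exists 1%N.
have I2 : `|\int[P]_t f (Num.min (V t) (2 ^+ m)) -
    weight_mean (w n) (fun x => f (Num.min x (2 ^+ m)))| <= e / 3 by near: n.
have I3 : `|weight_mean (w n) f -
    weight_mean (w n) (fun x => f (Num.min x (2 ^+ m)))| <= e / 3.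
  apply: le_trans Cm.
  apply: le_trans (_ : C * weight_mean (w n) (fun x => x - Num.min x (2 ^+ m)) <= _).
    rewrite -weight_meanB -weight_meanZ ler_norml -mulN1r -weight_meanZ.
    apply/andP; split; apply: weight_mean_le => // i; have := fd (w n i);
      by rewrite ler_norml ?mulN1r => /andP[].
  rewrite ler_wpM2l // weight_mean_minus_min_le // => x x1.
  exact: w_tail.
move: I1 I2 I3; rewrite !ler_norml => /andP[? ?] /andP[? ?] /andP[? ?].
by apply/andP; split; lra.
Unshelve. all: by end_near. Qed.

End weak_limit.

(** * The limiting variational problem *)

Section pressure_regularity.
Context {R : realType}.
Variables (I : finType) (q : nat) (v : I -> R).
Hypotheses (v_gt0 : forall i, 0 < v i) (q_gt0 : (0 < q)%N).

Lemma ln_expRD_dist (c x y : R) : 0 <= c ->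
  `|ln (expR x + c) - ln (expR y + c)| <= `|x - y|.
Proof.
move=> c0; wlog xy : x y / x <= y.
  by move=> h; have [/h//|/ltW/h] := leP x y; rewrite distrC (distrC y).
have pos (z : R) : 0 < expR z + c by rewrite ltr_pwDl ?expR_gt0.
rewrite !ler0_norm ?subr_le0 //; last by rewrite ler_ln ?posrE // lerD2r ler_expR.
by rewrite !opprB lerBlDl; exact: ln_expRD_lipschitz.
Qed.

Lemma mf_pressure_lipschitz (s s' : R) : 0 <= s <= 1 -> 0 <= s' <= 1 ->
  mf_pressure q v s <= mf_pressure q v s' + 2 * (\sum_i v i) * `|s - s'|.
Proof.
move=> /andP[s0 s1] /andP[s'0 s'1]; rewrite /mf_pressure.
set q1 : R := q%:R; have q1_ge1 : 1 <= q1 by rewrite ler1n.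
have h1 : \sum_i ln (expR (s * v i) + q1 - 1) <=
    \sum_i ln (expR (s' * v i) + q1 - 1) + (\sum_i v i) * `|s - s'|.
  rewrite mulr_suml -big_split /=; apply: ler_sum => i _.
  rewrite -!addrA -lerBlDl; apply: le_trans (ler_norm _) _.
  apply: le_trans (ln_expRD_dist _ _ _) _; first by rewrite subr_ge0.
  by rewrite -mulrBl normrM (gtr0_norm (v_gt0 i)) mulrC.
have L0 : 0 <= \sum_i v i by rewrite sumr_ge0 // => i _; rewrite ltW.
move: h1; set S1 := \sum_i ln _; set S2 := \sum_i ln _; set L := \sum_i v i in L0 *.
have h2 : ((q1 - 1) * s' ^+ 2 + 2 * s' - 1) - ((q1 - 1) * s ^+ 2 + 2 * s - 1) <=
    2 * q1 * `|s - s'|.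
  have -> : ((q1 - 1) * s' ^+ 2 + 2 * s' - 1) - ((q1 - 1) * s ^+ 2 + 2 * s - 1) =
      ((q1 - 1) * (s + s') + 2) * (s' - s) by ring.
  apply: le_trans (ler_norm _) _; rewrite normrM distrC ler_wpM2r //.
  rewrite ger0_norm; last by rewrite addr_ge0 // mulr_ge0 ?subr_ge0 // addr_ge0.
  have : (q1 - 1) * (s + s') <= (q1 - 1) * 2 by rewrite ler_wpM2l ?subr_ge0 //; lra.
  lra.
have q1_gt0 : 0 < q1 by exact: lt_le_trans q1_ge1.
have := ler_wpM2l (_ : 0 <= L / (2 * q1)) h2.
rewrite divr_ge0 ?mulr_ge0 ?(ltW q1_gt0) // => /(_ isT).
have -> : L / (2 * q1) * (2 * q1 * `|s - s'|) = L * `|s - s'|.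
  by field; rewrite gt_eqF.
rewrite mulrBr; lra.
Qed.

End pressure_regularity.

(** Tangent at 0 of a convex function, valid for all [x]; it serves where the weight is too large
    for the quadratic refinement. After division by [expR (x / q)] it follows from [1 + z <= e^z] at
    two points whose weighted mean is 0. *)
Lemma ln_expRD_ge_tangent (R : realType) (q x : R) : 1 <= q ->
  ln q + x / q <= ln (expR x + q - 1).
Proof.
move=> q1; have q0 : 0 < q by exact: lt_le_trans q1.
have pos : 0 < expR x + q - 1 by rewrite -addrA ltr_pwDl ?expR_gt0 ?subr_ge0.
rewrite -ler_expR expRD !lnK ?posrE //.
have h1 := expR_ge1Dx (x - x / q); have h2 := expR_ge1Dx (- (x / q)).
have -> : expR x + q - 1 = expR (x / q) * (expR (x - x / q) + (q - 1) * expR (- (x / q))).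
  rewrite mulrDr mulrCA expRxMexpNx_1 -expRD; rewrite (addrC (x / q)) subrK; ring.
rewrite mulrC ler_pM2l ?expR_gt0 //.
have : (q - 1) * (1 - x / q) <= (q - 1) * expR (- (x / q)) by rewrite ler_wpM2l ?subr_ge0.
have : q * (x / q) = x by rewrite mulrC divfK ?gt_eqF.
move: (x / q) h1 h2 => z; lra.
Qed.

(** Same factorisation with [y = x / q + x^2 / (32 q)], now keeping the second-order term of
    [e^(x - y)]. As [q >= 2] gives [x - y >= x / 4], that term is at least [x^2 / 32], exactly what
    [y] has in excess. *)
Lemma ln_expRD_ge_quadratic (R : realType) (q x : R) : 2 <= q -> 0 <= x <= 1 ->
  ln q + x / q + x ^+ 2 / (32 * q) <= ln (expR x + q - 1).
Proof.
move=> q2 /andP[x0 x1]; have q0 : 0 < q by exact: lt_le_trans q2.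
have pos : 0 < expR x + q - 1 by rewrite -addrA ltr_pwDl ?expR_gt0 // subr_ge0; lra.
pose y := x / q + x ^+ 2 / (32 * q).
have qy : q * y = x + x ^+ 2 / 32 by rewrite /y; field; rewrite gt_eqF.
have y0 : 0 <= y by rewrite addr_ge0 ?divr_ge0 ?mulr_ge0 ?sqr_ge0 // ltW.
have y_le : y <= 3 / 4 * x.
  have : 2 * y <= q * y by rewrite ler_wpM2r.
  have : x ^+ 2 <= x by rewrite expr2 ler_piMl.
  rewrite qy; lra.
have xy0 : 0 <= x - y by lra.
rewrite -addrA -/y -ler_expR expRD !lnK ?posrE //.
have h1 := expR_ge_taylor2 xy0; have h2 := expR_ge1Dx (- y).
have -> : expR x + q - 1 = expR y * (expR (x - y) + (q - 1) * expR (- y)).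
  rewrite mulrDr mulrCA expRxMexpNx_1 -expRD; rewrite (addrC y) subrK; ring.
rewrite mulrC ler_pM2l ?expR_gt0 //.
have h3 : (q - 1) * (1 - y) <= (q - 1) * expR (- y) by rewrite ler_wpM2l // subr_ge0; lra.
have h4 : (1 / 4 * x) ^+ 2 <= (x - y) ^+ 2.
  by rewrite ler_sqr ?nnegrE ?mulr_ge0 //; lra.
move: h4; rewrite exprMn => h4; move: qy h1 h3 h4.
set X := x ^+ 2; set Y := (x - y) ^+ 2; move: X Y => X Y; lra.
Qed.

(** * Limit of the annealed pressure *)

Section potts.
Context {R : realType} {d : measure_display} {T : measurableType d}.
Context {P : probability T R}.
Variables (q : nat) (beta : R) (W : {RV P >-> R}) (w : forall n, 'I_n -> R).
Arguments w : clear implicits.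
Hypotheses (w_cvg : weights_cvg_in_distribution W w)
  (w_gt0 : forall n i, 0 < w n i) (beta_gt0 : 0 < beta)
  (EW_gt0 : (0 < 'E_P[W])%E).
Variables (c tau : R).
Hypotheses (c_gt0 : 0 < c) (tau_gt2 : 2 < tau)
  (w_tail : forall (n : nat) (x : R), (0 < n)%N -> 1 <= x ->
       1 - weight_cdf (w n) x <= c * x `^ (- (tau - 1))).

Let b := expR beta - 1.
Let b_gt0 : 0 < b. Proof. by rewrite subr_gt0 expR_gt1. Qed.
Let V := positive_part W.
Let f s x : R := ln (expR (s * (b * x)) + q.+1%:R - 1).
Let mu := \int[P]_t V t.
Let p := potts_objective q.+1 beta W.
Let pn n s := n%:R^-1 * mf_pressure q.+1 (fun i => b * w n i) s.

Let iV : P.-integrable setT (EFin \o V).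
Proof. exact: (integrable_positive_part w_cvg w_gt0 c_gt0 tau_gt2 w_tail). Qed.

Let measurable_f s : measurable_fun setT (f s).
Proof.
apply: (measurableT_comp (@measurable_ln R)).
rewrite (_ : (fun _ => _) = (fun x => expR (s * (b * x)) + q%:R)); last first.
  by apply/funext => x; rewrite -natr1 addrA addrK.
apply: measurable_funD => //; apply: (measurableT_comp (@measurable_expR R)).
by apply: measurable_funM => //; exact: measurable_funM.
Qed.

Let f_lipschitz s x y : 0 <= s -> `|f s x - f s y| <= s * b * `|x - y|.
Proof.
move=> s0; rewrite /f -!addrA; apply: le_trans (ln_expRD_dist _ _ _) _.
  by rewrite subr_ge0 ler1n.
by rewrite -!mulrBr !normrM (ger0_norm s0) (gtr0_norm b_gt0) mulrA.
Qed.

Let mean_ge0 n : 0 <= weight_mean (w n) idfun.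
Proof.
by rewrite mulr_ge0 ?invr_ge0 // sumr_ge0 // => i _; exact: ltW (w_gt0 i).
Qed.

Let mean_cvg : weight_mean (w n) idfun @[n --> \oo] --> mu.
Proof.
apply: (weight_mean_cvg w_cvg w_gt0 c_gt0 tau_gt2 w_tail (f := idfun) (C := 1)) => //.
  exact: measurable_id.
by move=> x y; rewrite mul1r.
Qed.

Let EW : ('E_P[W] = mu%:E)%E.
Proof.
rewrite unlock (integral_positive_part w_cvg w_gt0 (f := idfun)); last first.
  exact: measurable_id.
by rewrite /mu /Rintegral fineK //; exact: integrable_fin_num.
Qed.

Let mu_gt0 : 0 < mu.
Proof. by rewrite -lte_fin -EW. Qed.

Lemma potts_objectiveE s : p s =
  \int[P]_t f s (V t) - b * mu / (2 * q.+1%:R) *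
    ((q.+1%:R - 1) * s ^+ 2 + 2 * s - 1).
Proof.
rewrite /p /potts_objective EW /=; congr (_ - _).
rewrite unlock /Rintegral; congr fine.
rewrite -(integral_positive_part w_cvg w_gt0 (measurable_f s)).
by apply: eq_integral => t _; rewrite /f mulrC mulrA.
Qed.

Let pnE n s : pn n s = weight_mean (w n) (f s) -
  b * weight_mean (w n) idfun / (2 * q.+1%:R) *
    ((q.+1%:R - 1) * s ^+ 2 + 2 * s - 1).
Proof.
rewrite /pn /mf_pressure mulrBr -mulr_sumr /weight_mean; congr (_ - _).
by rewrite -/b; ring.
Qed.

Lemma pn_cvg s : 0 <= s -> pn n s @[n --> \oo] --> p s.
Proof.
move=> s0; rewrite potts_objectiveE; under eq_fun do rewrite pnE.
apply: cvgB.
  apply: (weight_mean_cvg w_cvg w_gt0 c_gt0 tau_gt2 w_tail (C := s * b)) => //.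
    by rewrite mulr_ge0 // ltW.
  by move=> x y; exact: f_lipschitz.
by apply: cvgMr_tmp; apply: cvgMr_tmp; apply: cvgMl_tmp; exact: mean_cvg.
Qed.

Let pn_lipschitz n s s' : 0 <= s <= 1 -> 0 <= s' <= 1 ->
  pn n s <= pn n s' + 2 * b * weight_mean (w n) idfun * `|s - s'|.
Proof.
move=> s01 s'01.
have bw i : 0 < b * w n i by rewrite mulr_gt0.
have := mf_pressure_lipschitz bw (ltn0Sn q) s01 s'01.
have n0 : 0 <= n%:R^-1 :> R by rewrite invr_ge0.
move=> /(ler_wpM2l n0) h; apply: le_trans h _; rewrite [leLHS]mulrDr.
by rewrite lerD2l -mulr_sumr /weight_mean le_eqVlt; apply/orP; left; apply/eqP; ring.
Qed.

Lemma potts_objective_lipschitz s s' : 0 <= s <= 1 -> 0 <= s' <= 1 ->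
  p s <= p s' + 2 * b * mu * `|s - s'|.
Proof.
move=> s01 s'01; have [/andP[s0 _] /andP[s'0 _]] := (s01, s'01).
apply: ler_cvg_to (pn_cvg s0) _ _; last first.
  by apply: nearW => n; exact: pn_lipschitz s01 s'01.
by apply: cvgD; [exact: pn_cvg | apply: cvgMr_tmp; apply: cvgMl_tmp; exact: mean_cvg].
Qed.

Let sp := potts_sup q.+1 beta W.

Lemma potts_objective_has_sup : has_sup [set p s | s in `[0, 1]].
Proof.
split; first by exists (p 0), 0 => //=; rewrite in_itv /= lexx ler01.
exists (p 0 + 2 * b * mu * 1) => _ [s /= s01 <-]; rewrite in_itv /= in s01.
apply: le_trans (potts_objective_lipschitz s01 (_ : 0 <= 0 <= 1)) _.
  by rewrite lexx ler01.
case/andP: s01 => s0 s1; rewrite lerD2l subr0 ger0_norm // ler_wpM2l //.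
by rewrite !mulr_ge0 // ltW.
Qed.

Lemma potts_objective_le_sup s : 0 <= s <= 1 -> p s <= sp.
Proof.
move=> s01; apply: sup_upper_bound; first exact: potts_objective_has_sup.
by exists s => //=; rewrite in_itv.
Qed.

(** Convergence on a finite grid of [s] becomes uniform because the Lipschitz constants of the
    [pn n] are bounded along with the mean weights. *)
Lemma pn_le_sup e : 0 < e ->
  \forall n \near \oo, forall s, 0 <= s <= 1 -> pn n s <= sp + e.
Proof.
move=> e0.
have mu1 : 0 < mu + 1 by rewrite addr_gt0.
pose C := 2 * b * (mu + 1).
have C0 : 0 < C by rewrite !mulr_gt0.
pose N := (Num.truncn (C / (e / 2))).+1.
have N0 : 0 < N%:R :> R by rewrite ltr0n.
have CN : C / N%:R <= e / 2.
  rewrite ler_pdivrMr // mulrC -ler_pdivrMr ?divr_gt0 //.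
  exact/ltW/truncnS_gt.
pose sj (j : 'I_N.+1) : R := j%:R / N%:R.
have sj01 j : 0 <= sj j <= 1.
  by rewrite divr_ge0 //= ler_pdivrMr // mul1r ler_nat -ltnS ltn_ord.
have grid : \forall n \near \oo, forall j : 'I_N.+1, pn n (sj j) <= sp + e / 2.
  apply: filter_forall => j.
  have /andP[sj0 _] := sj01 j.
  have /cvgrPdist_le /(_ _ (divr_gt0 e0 (ltr0Sn _ 1))) := pn_cvg sj0.
  apply: filterS => n; rewrite ler_norml => /andP[h _].
  have := potts_objective_le_sup (sj01 j); lra.
have mean1 : \forall n \near \oo, weight_mean (w n) idfun <= mu + 1.
  have /cvgrPdist_le /(_ _ ltr01) := mean_cvg.
  by apply: filterS => n; rewrite ler_norml => /andP[h _]; lra.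
near=> n => s s01.
have hg : forall j : 'I_N.+1, pn n (sj j) <= sp + e / 2 by near: n.
have hm : weight_mean (w n) idfun <= mu + 1 by near: n.
case/andP: (s01) => s0 s1.
have sN : 0 <= s * N%:R by rewrite mulr_ge0.
have /andP[t1 t2] := truncn_itv sN.
have tN : (Num.truncn (s * N%:R) < N.+1)%N.
  by rewrite ltnS -(ler_nat R) (le_trans t1) // ler_piMl.
pose j := Ordinal tN.
have sd : `|s - sj j| <= N%:R^-1.
  have -> : s - sj j = (s * N%:R - (Num.truncn (s * N%:R))%:R) / N%:R.
    by rewrite /sj /=; field; rewrite gt_eqF.
  rewrite normrM ger0_norm ?subr_ge0 // ger0_norm ?invr_ge0 ?(ltW N0) //.
  rewrite ler_piMl ?invr_ge0 ?(ltW N0) // lerBlDr addrC natr1.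
  exact: ltW.
apply: le_trans (pn_lipschitz n s01 (sj01 j)) _.
apply: le_trans (_ : pn n (sj j) + C / N%:R <= _); last by have := hg j; lra.
rewrite lerD2l; apply: ler_pM => //.
- by rewrite mulr_ge0 // mulr_ge0 // ltW.
- by rewrite ler_wpM2l // mulr_ge0 // ltW.
Unshelve. all: by end_near. Qed.

Let weight_mean_total n : (0 < n)%N ->
  total_weight (w n) = n%:R * weight_mean (w n) idfun.
Proof.
by move=> n0; rewrite /weight_mean mulrA mulfV ?mul1r // gt_eqF // ltr0n.
Qed.

(** The truncation level [2^m] is fixed first, to make the truncated mass small; the remaining error
    is bounded in [n] and disappears after division by [n]. *)
Lemma annealed_pressure_ge s e : 0 <= s <= 1 -> 0 < e ->
  \forall n \near \oo, p s - e <= annealed_pressure q.+1 beta (w n).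
Proof.
move=> s01 e0; have /andP[s0 _] := s01.
have e3 : 0 < e / 3 by rewrite divr_gt0.
have [m hm] : exists m, 2 * b * tail_bound c tau m <= e / 3.
  have e6 : 0 < e / (6 * b) by rewrite divr_gt0 // mulr_gt0.
  have /cvgrPdist_le /(_ _ e6) [m _ hm] := tail_bound_cvg0 c tau_gt2.
  exists m; have := hm m (leqnn m); rewrite sub0r normrN ger0_norm ?tail_bound_ge0 //.
  have b2 : 0 <= 2 * b by rewrite mulr_ge0 // ltW.
  move=> /(ler_wpM2l b2) h; apply: le_trans h _.
  by rewrite le_eqVlt; apply/orP; left; apply/eqP; field; rewrite gt_eqF.
pose M : R := 2 ^+ m; have M_gt0 : 0 < M by rewrite exprn_gt0.
pose A := b * M ^+ 2.
have A_gt0 : 0 < A by rewrite mulr_gt0 // exprn_gt0.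
(* Bound on the error of [ln_expected_partition_ge] once the total weight is at least [n mu / 2],
   that is, [n / l <= 2 / mu]. *)
pose K := A / 2 + (A / mu + 2 * A ^+ 2 / mu ^+ 2).
have K_gt0 : 0 < K by rewrite !addr_gt0 ?divr_gt0 ?mulr_gt0 ?exprn_gt0.
have mu2 : 0 < mu / 2 by rewrite divr_gt0.
have n_large : \forall n \near \oo, K / (e / 3) <= n%:R.
  exists (Num.truncn (K / (e / 3))).+1 => // n /= hn.
  by apply: le_trans (ltW (truncnS_gt _)) _; rewrite ler_nat.
have pns : \forall n \near \oo, p s - e / 3 <= pn n s.
  have /cvgrPdist_le /(_ _ e3) := pn_cvg s0.
  by apply: filterS => n; rewrite ler_norml => /andP[_]; lra.
have mean2 : \forall n \near \oo, mu / 2 <= weight_mean (w n) idfun.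
  have /cvgrPdist_le /(_ _ mu2) := mean_cvg.
  by apply: filterS => n; rewrite ler_norml => /andP[_]; lra.
near=> n.
have n0 : (0 < n)%N by near: n; exists 1%N.
have nR0 : 0 < n%:R :> R by rewrite ltr0n.
have hK : K / (e / 3) <= n%:R by near: n.
have hp : p s - e / 3 <= pn n s by near: n.
have hmu : mu / 2 <= weight_mean (w n) idfun by near: n.
set l := total_weight (w n).
have hl : n%:R * (mu / 2) <= l by rewrite /l weight_mean_total // ler_pM2l.
have l0 : 0 < l by apply: lt_le_trans hl; rewrite mulr_gt0.
have := @ln_expected_partition_ge _ q n beta (w n) beta_gt0 (@w_gt0 n) n0 M s M_gt0 s01.
have nV : 0 <= n%:R^-1 :> R by rewrite invr_ge0.
move=> /(ler_wpM2l nV); rewrite -/(annealed_pressure q.+1 beta (w n)).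
have distr (x y z t : R) : t * (x - y - z) = t * x - t * y - t * z by ring.
apply: le_trans; rewrite -/l -/b distr -/(pn n s).
have h2 : n%:R^-1 * (2 * b * \sum_i (w n i - Num.min (w n i) M)) <= e / 3.
  apply: le_trans hm; rewrite mulrCA ler_wpM2l ?mulr_ge0 ?(ltW b_gt0) //.
  apply: (weight_mean_minus_min_le c_gt0 tau_gt2 n0) => x x1.
  exact: w_tail.
have h3 : n%:R^-1 * (b * M ^+ 2 / 2 + (n%:R * b * M ^+ 2 / (2 * l) +
      (n%:R * b * M ^+ 2) ^+ 2 / (2 * l ^+ 2))) <= e / 3.
  apply: le_trans (_ : n%:R^-1 * K <= _).
    rewrite ler_wpM2l // /K -/A lerD2l.
    have nl : n%:R / l <= 2 / mu.
      rewrite ler_pdivrMr // mulrAC ler_pdivlMr //.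
      by move: hl; lra.
    have nl0 : 0 <= n%:R / l by rewrite divr_ge0 // ltW.
    have -> : n%:R * b * M ^+ 2 / (2 * l) = A / 2 * (n%:R / l).
      by rewrite /A; field; rewrite gt_eqF.
    have -> : (n%:R * b * M ^+ 2) ^+ 2 / (2 * l ^+ 2) = A ^+ 2 / 2 * (n%:R / l) ^+ 2.
      by rewrite /A; field; rewrite gt_eqF.
    have -> : A / mu = A / 2 * (2 / mu) by field; rewrite gt_eqF.
    have -> : 2 * A ^+ 2 / mu ^+ 2 = A ^+ 2 / 2 * (2 / mu) ^+ 2 by field; rewrite gt_eqF.
    apply: lerD; apply: ler_wpM2l; rewrite ?divr_ge0 ?sqr_ge0 ?(ltW A_gt0) //.
    by rewrite ler_sqr ?nnegrE // (le_trans nl0).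
  by rewrite mulrC ler_pdivrMr // mulrC -ler_pdivrMr.
lra.
Unshelve. all: by end_near. Qed.

(** The grid size [N] is fixed first, to make the rounding error per vertex small; the count of grid
    points then vanishes after division by [n]. *)
Lemma annealed_pressure_le e : 0 < e ->
  \forall n \near \oo, annealed_pressure q.+1 beta (w n) <= sp + e.
Proof.
move=> e0; have e3 : 0 < e / 3 by rewrite divr_gt0.
pose q1 : R := q.+1%:R.
have q1_gt0 : 0 < q1 by rewrite ltr0n.
have mu1 : 0 < mu + 1 by rewrite addr_gt0.
pose C := q1 * b * (mu + 1) / 2.
have C0 : 0 < C by rewrite divr_gt0 // !mulr_gt0.
pose N := (Num.truncn (C / (e / 3))).+1.
have N0 : 0 < N%:R :> R by rewrite ltr0n.
have N1 : 1 <= N%:R :> R by rewrite ler1n.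
have CN : C / N%:R <= e / 3.
  rewrite ler_pdivrMr // mulrC -ler_pdivrMr //.
  exact/ltW/truncnS_gt.
pose K := q1 * ln N.+1%:R.
have n_large : \forall n \near \oo, K / (e / 3) <= n%:R.
  exists (Num.truncn (K / (e / 3))).+1 => // n /= hn.
  by apply: le_trans (ltW (truncnS_gt _)) _; rewrite ler_nat.
have mean1 : \forall n \near \oo, weight_mean (w n) idfun <= mu + 1.
  have /cvgrPdist_le /(_ _ ltr01) := mean_cvg.
  by apply: filterS => n; rewrite ler_norml => /andP[h _]; lra.
have sup_e := pn_le_sup e3.
near=> n.
have n0 : (0 < n)%N by near: n; exists 1%N.
have nR0 : 0 < n%:R :> R by rewrite ltr0n.
have hK : K / (e / 3) <= n%:R by near: n.
have hm : weight_mean (w n) idfun <= mu + 1 by near: n.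
have hs : forall s, 0 <= s <= 1 -> pn n s <= sp + e / 3 by near: n.
have hB s : 0 <= s <= 1 -> mf_pressure q.+1 (fun i => b * w n i) s <= n%:R * (sp + e / 3).
  by move=> /hs; rewrite /pn ler_pdivrMl.
have := ln_expected_partition_le beta_gt0 (@w_gt0 n) n0 (ltn0Sn _ : (0 < N)%N) hB.
have nV : 0 <= n%:R^-1 :> R by rewrite invr_ge0.
move=> /(ler_wpM2l nV); rewrite -/(annealed_pressure q.+1 beta (w n)) => h.
have distr (x y z : R) : n%:R^-1 * (n%:R * x + y + z) = x + n%:R^-1 * y + n%:R^-1 * z.
  by field; rewrite gt_eqF.
apply: le_trans h _; rewrite -/b -/q1 -/K distr.
have h1 : n%:R^-1 * K <= e / 3 by rewrite ler_pdivrMl // -ler_pdivrMr.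
have h2 : n%:R^-1 * (q1 * (\sum_i b * w n i) / (2 * N%:R ^+ 2)) <= e / 3.
  apply: le_trans CN.
  have -> : n%:R^-1 * (q1 * (\sum_i b * w n i) / (2 * N%:R ^+ 2)) =
      q1 * b * weight_mean (w n) idfun / 2 / N%:R ^+ 2.
    rewrite -mulr_sumr /weight_mean; field.
    by rewrite !gt_eqF.
  apply: ler_pM.
  - by rewrite divr_ge0 // mulr_ge0 // mulr_ge0 // ltW.
  - by rewrite invr_ge0 exprn_ge0.
  - by rewrite ler_pM2r // ler_pM2l // mulr_gt0.
  (* The cruder [1 / N^2 <= 1 / N] suffices for the choice of [N]. *)
  by rewrite lef_pV2 ?posrE ?exprn_gt0 // expr2 ler_peMl // ltW.
lra.
Unshelve. all: by end_near. Qed.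

Lemma annealed_pressure_cvg : annealed_pressure q.+1 beta (w n) @[n --> \oo] --> sp.
Proof.
apply/cvgrPdist_le => e e0; have e2 : 0 < e / 2 by rewrite divr_gt0.
have [_ [s s01 <-] hs] := sup_adherent e2 potts_objective_has_sup.
rewrite /= in_itv /= in s01.
near=> n.
have h1 : annealed_pressure q.+1 beta (w n) <= sp + e.
  by near: n; exact: annealed_pressure_le.
have h2 : p s - e / 2 <= annealed_pressure q.+1 beta (w n).
  by near: n; exact: annealed_pressure_ge.
rewrite -/sp /potts_sup -/p in hs; rewrite ler_norml; apply/andP; split; first lra.
move: hs; rewrite -[sup _]/sp; lra.
Unshelve. all: by end_near. Qed.

(** * Positivity of the optimizer *)

Hypothesis EW2_infty : ('E_P[(fun t : T => (W t ^+ 2)%R)] = +oo)%E.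
Hypothesis q_gt0 : (0 < q)%N.

(** The cut [V <= k] is the range [beta' s V <= 1] of the quadratic bound when
    [s = 1 / (beta' k)]. *)
Let J (k : nat) t : R := V t ^+ 2 * (V t <= k%:R)%R%:R.

Let V0 t : 0 <= V t. Proof. exact: positive_part_ge0. Qed.

Let mV : measurable_fun setT V. Proof. exact: measurable_positive_part. Qed.

Let measurable_J k : measurable_fun setT (J k).
Proof.
apply: (@measurableT_comp _ _ _ _ _ _ (fun x : R => x ^+ 2 * (x <= k%:R)%R%:R)) => //.
apply: measurable_funM; first exact: measurable_funX.
rewrite (_ : (fun _ => _) = \1_(`]-oo, k%:R]%classic : set R)) //.
by apply/funext => y; rewrite indicE mem_setE in_itv.
Qed.

Let integrable_J k : P.-integrable setT (EFin \o J k).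
Proof.
apply: measurable_bounded_integrable => //.
  by rewrite (le_lt_trans (probability_le1 P measurableT)) ?ltry.
exists (k%:R ^+ 2); split; first exact: num_real.
move=> B' BB' t _; apply: le_trans (ltW BB'); rewrite /= /J.
have [Vk|_] := leP (V t) k%:R; last by rewrite mulr0 normr0 sqr_ge0.
by rewrite mulr1 ger0_norm ?sqr_ge0 // ler_sqr ?nnegrE.
Qed.

Lemma truncated_second_moment_cvg : (\int[P]_t (J k t)%:E)%E @[k --> \oo] --> +oo%E.
Proof.
have <- : (\int[P]_t limn (fun k => (J k t)%:E) = +oo)%E.
  rewrite -EW2_infty unlock.
  rewrite (integral_positive_part w_cvg w_gt0 (f := fun x => x ^+ 2)); last first.
    exact: measurable_funX.
  apply: eq_integral => t _; apply/cvg_lim => //.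
  apply: cvg_near_cst; near=> k; rewrite /J.
  have -> : V t <= k%:R; last by rewrite mulr1.
  apply: le_trans (ltW (truncnS_gt (V t))) _; rewrite ler_nat.
  by near: k; exists (Num.truncn (V t)).+1.
apply: cvg_monotone_convergence => //.
- by move=> k; apply/measurable_EFinP; exact: measurable_J.
- by move=> k t _; rewrite lee_fin mulr_ge0 ?sqr_ge0.
move=> t _ i j ij; rewrite lee_fin ler_wpM2l ?sqr_ge0 //.
have [Vi|_] := leP (V t) i%:R => //.
by rewrite (le_trans Vi) // ler_nat.
Unshelve. all: by end_near. Qed.

(** In [p s - p 0] the linear terms cancel. The quadratic loss has a fixed coefficient, while the
    gain is proportional to a truncated second moment that grows without bound with [k]. *)
Lemma potts_objective_gt_at0 : exists2 s, 0 <= s <= 1 & p 0 < p s.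
Proof.
pose q1 : R := q.+1%:R.
have q1_ge2 : 2 <= q1 by rewrite ler_nat.
have q1_gt0 : 0 < q1 by exact: lt_le_trans q1_ge2.
(* [A - 1] is the ratio of the loss to the gain per unit of truncated second moment; the extra 1
   makes the inequality strict. *)
pose A := 16 * mu * (q1 - 1) / b + 1.
have [k kA kb] : exists2 k : nat, A <= \int[P]_t J k t & b^-1 + 1 <= k%:R.
  have /cvgeyPge /(_ A) hA := truncated_second_moment_cvg.
  have hB : \forall k \near \oo, b^-1 + 1 <= k%:R.
    exists (Num.truncn (b^-1 + 1)).+1 => // k /= hk.
    by apply: le_trans (ltW (truncnS_gt _)) _; rewrite ler_nat.
  have [k [h1 h2]] := filter_ex (filterI hA hB).
  exists k => //; rewrite -lee_fin fineK //.
  by apply: integrable_fin_num => //; exact: integrable_J.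
have k0 : 0 < k%:R :> R by apply: lt_le_trans kb; rewrite addr_gt0 // invr_gt0.
(* The condition [b^-1 + 1 <= k] ensures [s <= 1]. *)
pose s := (b * k%:R)^-1.
have s_gt0 : 0 < s by rewrite invr_gt0 mulr_gt0.
have s1 : s <= 1.
  rewrite invf_le1 ?mulr_gt0 // mulrC -ler_pdivrMr // div1r.
  by apply: le_trans kb; rewrite lerDl.
exists s; first by rewrite ltW.
have sb : s * b * k%:R = 1 by rewrite /s; field; rewrite !gt_eqF.
have lower t : ln q1 + s * b / q1 * V t + (s * b) ^+ 2 / (32 * q1) * J k t <= f s (V t).
  rewrite /f /J mulrA -/q1; have [Vk|_] := leP (V t) k%:R.
    have := @ln_expRD_ge_quadratic _ q1 (s * b * V t) q1_ge2.
    have -> : 0 <= s * b * V t <= 1.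
      have sb0 : 0 <= s * b by rewrite mulr_ge0 // ltW.
      by rewrite mulr_ge0 //= -sb ler_wpM2l.
    move=> /(_ isT); apply: le_trans; rewrite mulr1 exprMn.
    by rewrite le_eqVlt; apply/orP; left; apply/eqP; ring.
  have := @ln_expRD_ge_tangent _ q1 (s * b * V t) _.
  rewrite mulr0 mulr0 addr0 => h; apply: le_trans (h _); last by lra.
  by rewrite mulrAC.
have ifs : P.-integrable setT (EFin \o (fun t => f s (V t))).
  apply: (@integrable_lipschitz_comp _ _ _ P (f s) (s * b) V) => //.
  by move=> x y; apply: f_lipschitz; exact: ltW.
have i1 : P.-integrable setT (EFin \o (fun t : T => ln q1)).
  exact: finite_measure_integrable_cst.
have i2 : P.-integrable setT (EFin \o (fun t => s * b / q1 * V t)).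
  exact: (integrableZl measurableT _ iV).
have i3 : P.-integrable setT (EFin \o (fun t => (s * b) ^+ 2 / (32 * q1) * J k t)).
  exact: (integrableZl measurableT _ (integrable_J k)).
have i12 : P.-integrable setT (EFin \o (fun t => ln q1 + s * b / q1 * V t)).
  exact: (integrableD measurableT i1 i2).
have i123 : P.-integrable setT (EFin \o (fun t =>
    ln q1 + s * b / q1 * V t + (s * b) ^+ 2 / (32 * q1) * J k t)).
  exact: (integrableD measurableT i12 i3).
have cst_int a : \int[P]_(t in setT) a = a.
  by rewrite Rintegral_cst // (congr1 fine (probability_setT P)) mulr1.
have := le_Rintegral measurableT i123 ifs (fun t _ => lower t).
rewrite RintegralD // RintegralD // RintegralZl // RintegralZl // cst_int -/mu => h.
have p0E : p 0 = ln q1 + b * mu / (2 * q1).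
  rewrite potts_objectiveE (_ : (fun t => f 0 (V t)) = (fun=> ln q1)).
    by rewrite cst_int -/q1; ring.
  by apply/funext => t; rewrite /f mul0r expR0 -/q1 addrAC subrr add0r.
rewrite p0E potts_objectiveE -/q1.
have : b * mu / (2 * q1) * (q1 - 1) * s ^+ 2 < (s * b) ^+ 2 / (32 * q1) * \int[P]_t J k t.
  have -> : b * mu / (2 * q1) * (q1 - 1) * s ^+ 2 = (s * b) ^+ 2 / (32 * q1) * (A - 1).
    by rewrite /A; field; rewrite !gt_eqF.
  rewrite ltr_pM2l; first by rewrite ltrBlDr (le_lt_trans kA) // ltrDl.
  by rewrite divr_gt0 ?exprn_gt0 ?mulr_gt0.
have -> : b * mu / (2 * q1) * ((q1 - 1) * s ^+ 2 + 2 * s - 1) =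
    b * mu / (2 * q1) * (q1 - 1) * s ^+ 2 + s * b / q1 * mu - b * mu / (2 * q1).
  by field; rewrite gt_eqF.
move: h; set IJ := \int[P]_x J k x; set IF := \int[P]_x f s (V x).
set a1 := s * b / q1 * mu; set a2 := (s * b) ^+ 2 / (32 * q1) * IJ.
set a3 := b * mu / (2 * q1) * (q1 - 1) * s ^+ 2; set a4 := b * mu / (2 * q1).
clearbody a1 a2 a3 a4 IF; lra.
Qed.

Lemma optimizer_gt0 s : optimizer q.+1 beta W s -> 0 < s.
Proof.
move=> [s01]; rewrite -/(p s) -/sp => ps; rewrite in_itv /= in s01.
case/andP: s01 => s0 _; rewrite lt_neqAle s0 andbT; apply/eqP => s0E.
have [s' s'01] := potts_objective_gt_at0; rewrite s0E ps ltNge.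
by rewrite potts_objective_le_sup.
Qed.

End potts.

Theorem theorem1p6 (R : realType) (q : nat) (q_ge2 : (2 <= q)%N)
    (beta : R) (beta_gt0 : 0 < beta)
    (w : forall n : nat, 'I_n -> R)
    (w_gt0 : forall (n : nat) (i : 'I_n), 0 < w n i)
    (d : measure_display) (T : measurableType d) (P : probability T R)
    (W : {RV P >-> R})
    (w_cvg : weights_cvg_in_distribution W w)
    (EW_gt0 : (0 < 'E_P[W])%E)
    (c tau : R) (c_gt0 : 0 < c) (tau_gt2 : 2 < tau)
    (w_tail : forall (n : nat) (x : R), (0 < n)%N -> 1 <= x ->
       1 - weight_cdf (w n) x <= c * x `^ (- (tau - 1)))
    (EW2_infty : ('E_P[(fun t : T => (W t ^+ 2)%R)] = +oo)%E) :
  annealed_pressure q beta (w n) @[n --> \oo] --> potts_sup q beta W /\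
  (forall s : R, optimizer q beta W s -> 0 < s).
Proof.
(* The lemmas count colours as [q.+1]; [2 <= q.+1] is convertible to [0 < q]. *)
case: q q_ge2 => // q q_ge2; split.
  exact: (@annealed_pressure_cvg R d T P q beta W w w_cvg w_gt0 beta_gt0 EW_gt0
    c tau c_gt0 tau_gt2 w_tail).
move=> s; exact: (optimizer_gt0 w_cvg w_gt0 beta_gt0 EW_gt0 c_gt0 tau_gt2 w_tail
  EW2_infty q_ge2).
Qed.
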